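(* Let $\psi:\mathbb{R}\to\mathbb{R}$ be a real wavelet, let $\mathcal{H}\{\psi\}$ be its Hilbert transform, and let $\psi_F(t)=\frac{1}{\sqrt2}\left[\psi(t)-j\,\mathcal{H}\{\psi\}(t)\right]$ be the associated Fourier-Like wavelet. Then $\psi_F$ is also a wavelet, and it has the same energy and the same admissibility coefficient as $\psi$, that is, $\mathcal{E}[\psi_F]=\mathcal{E}[\psi]$ and $C[\psi_F]=C[\psi]$.
   Context: The Fourier transform of $f\in L^2(\mathbb{R})$ (complex-valued functions allowed) is the $L^2$ Fourier transform with the convention $F(\omega)=\int_{-\infty}^{\infty} f(t)e^{-j\omega t}\,dt$, where $j=\sqrt{-1}$. The energy of $f$ is $\mathcal{E}[f]=\int_{-\infty}^{\infty}|f(t)|^2\,dt$. The admissibility coefficient of $f$ is $C[f]=\int_{-\infty}^{\infty}\frac{|F(\omega)|^2}{|\omega|}\,d\omega$. A function $f$ is a (mother) wavelet if and only if (i) $f\in L^2(\mathbb{R})$ (finite energy) and (ii) $f$ satisfies the admissibility condition $C[f]<+\infty$. A real wavelet is a real-valued wavelet. The Hilbert transform of $f$ is $\mathcal{H}\{f\}(t)=\mathrm{p.v.}\,\frac{1}{\pi}\int_{-\infty}^{\infty}\frac{f(\tau)}{t-\tau}\,d\tau$ (Cauchy principal value); equivalently, the Fourier transform of $\mathcal{H}\{f\}$ is $-j\,\mathrm{sgn}(\omega)F(\omega)$, where $\mathrm{sgn}(\omega)=1,0,-1$ for $\omega>0$, $\omega=0$, $\omega<0$ respectively. *)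

(* Defs.v *)
From HB Require Import structures.
From mathcomp Require Export all_boot all_order all_algebra.
From mathcomp Require Export all_classical all_reals all_analysis.
From mathcomp Require Export complex.

Set Implicit Arguments.
Unset Strict Implicit.
Unset Printing Implicit Defensive.

Import Order.TTheory GRing.Theory Num.Theory Normc.
Import numFieldNormedType.Exports.

Local Open Scope classical_set_scope.
Local Open Scope ring_scope.
Local Open Scope complex_scope.

Section wavelets.
Context {R : realType}.
Local Notation mu := (@lebesgue_measure R).
Implicit Types (f F : R -> R[i]) (x : R -> R).

Definition energy f : \bar R := (\int[mu]_t ((normc (f t)) ^+ 2)%:E)%E.

Definition finite_energy f : Prop :=
  [/\ measurable_fun [set: R] (fun t => complex.Re (f t)),
      measurable_fun [set: R] (fun t => complex.Im (f t)) &
      (energy f < +oo)%E].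

(* Componentwise Lebesgue integral; meaningful when both components are
   integrable on D. *)
Definition cintegral (D : set R) f : R[i] :=
  (\int[mu]_(t in D) complex.Re (f t)) +i* (\int[mu]_(t in D) complex.Im (f t)).

(* expi a is e^{ja}. *)
Definition expi (a : R) : R[i] := cos a +i* sin a.

(* A square-integrable f need not be integrable on R, but it is on [-n, n]. *)
Definition truncated_fourier f (n : nat) (w : R) : R[i] :=
  cintegral `[- n%:R, n%:R] (fun t => f t * expi (- (w * t))).

(* Fourier-Plancherel transform: F is the limit in the mean of the truncated
   integrals.  It determines F up to equality almost everywhere. *)
Definition is_fourier f F : Prop :=
  finite_energy F /\
  energy (fun w => truncated_fourier f n w - F w) @[n --> \oo] --> 0%E.

(* A representative of the L^2 Fourier transform; it is a junk value (zero)
   when f has no such transform. *)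
Definition fourier f : R -> R[i] := xget (fun=> 0) [set F | is_fourier f F].

(* At w = 0, a null set, the integrand takes the value 0 as 0^-1 = 0. *)
Definition admissibility_coef f : \bar R :=
  (\int[mu]_w ((normc (fourier f w)) ^+ 2 / `|w|)%:E)%E.

Definition wavelet f : Prop :=
  finite_energy f /\ (admissibility_coef f < +oo)%E.

(* Cauchy principal value at the singularity tau = t.  For square-integrable x
   the integral over |t - tau| > e converges absolutely for each e > 0, so no
   truncation at infinity is needed.  The limit exists for almost every t;
   where it does not, lim returns a default value. *)
Definition hilbert x (t : R) : R :=
  lim ((pi^-1 * \int[mu]_(tau in [set tau : R | (e < `|t - tau|)%R])
                  (x tau / (t - tau))) @[e --> 0^'+]).

Definition complex_of_real x : R -> R[i] := fun t => (x t)%:C.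

Definition fourier_like x : R -> R[i] :=
  fun t => ((Num.sqrt 2)^-1)%:C * ((x t)%:C - 'i%C * (hilbert x t)%:C).

End wavelets.

(* Main.v *)
From HB Require Import structures.
Require Import Defs.
From mathcomp Require Import ring lra measurable_realfun.

(** Let F be the Fourier transform of the real wavelet psi. The Hilbert transform
    multiplies F by -j sgn, so the Fourier-like wavelet has the transform
    (1 - sgn) F / sqrt 2. Its square modulus is 2 |F|^2 for negative frequencies and 0
    for positive ones; as psi is real, |F|^2 is even, so weighting by 1/|w| and
    integrating gives the admissibility coefficient of psi. The energies agree because
    the Hilbert transform is an isometry and the factor 1/sqrt 2 averages the energies
    of psi and of its Hilbert transform.

    The work lies in the facts behind this computation: existence, uniqueness and
    isometry of the Fourier transform in mean, and the identification of the principal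
    value with the multiplier. As all functions reduce to real ones, the Fourier
    transform is replaced by the Hartley transform, with the real symmetric kernel
    cas = cos + sin; its even and odd parts are the cosine and sine transforms.

    Plancherel. With the factor exp(-e|w|) every integral converges, and by the
    multiplication formula (hartley_sym) the quadratic form of the transform becomes
    the quadratic form of the Poisson kernel (bessel_abel), which is bounded by the
    square norm (schur_poisson). For e tending to 0 this gives a bounded transform
    (bessel), which extends by completeness (riesz_fischer, is_hartley_ex). Applying the
    transform twice gives Poisson means, which converge at Lebesgue points
    (poisson_err_small); hence the inversion formula (is_hartley_inv), and the two
    bounds together force isometry (is_hartley_isometry).

    Hilbert transform. If h is the Hartley transform of f, let g be the function with
    transform sgn(w) h(-w). The Poisson means of g are the conjugate Poisson means of f
    (conj_poisson_conv), and these differ from the truncated principal value integrals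
    by a quantity that the Poisson kernel controls at Lebesgue points
    (far_int_dist). So the principal value exists and equals g almost everywhere
    (hilbert_ae). Finite energy also asks for Borel measurability of the principal
    value as a pointwise limit (mf_hilbert). *)

Set Implicit Arguments.
Unset Strict Implicit.
Unset Printing Implicit Defensive.

Import Order.TTheory GRing.Theory Num.Theory Normc.
Import numFieldNormedType.Exports.

Local Open Scope classical_set_scope.
Local Open Scope ring_scope.

(** * Integrable functions on the line *)

Section L1.
Context {R : realType}.
Local Notation mu := (@lebesgue_measure R).
Local Notation mf f := (measurable_fun [set: R] (f : R -> R)).

Definition L1 (f : R -> R) : Prop := mu.-integrable setT (EFin \o f).
Definition L2 (f : R -> R) : Prop := mf f /\ L1 (fun x => f x ^+ 2).
Definition sqnorm (f : R -> R) : R := \int[mu]_x (f x ^+ 2).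

Lemma L1_mf f : L1 f -> mf f.
Proof. by move=> /measurable_int /measurable_EFinP. Qed.

Lemma L1_le f g : mf f -> L1 g -> (forall x, `|f x| <= g x) -> L1 f.
Proof.
move=> mf' Lg fg; apply: (le_integrable _ _ _ Lg) => //; first exact/measurable_EFinP.
by move=> x _ /=; rewrite lee_fin (le_trans (fg x))// ler_norm.
Qed.

Lemma L1P f : mf f -> (\int[mu]_x `|f x|%:E < +oo)%E -> L1 f.
Proof. by move=> mf' h; apply/integrableP; split; [exact/measurable_EFinP|]. Qed.

Lemma L1_norm f : L1 f -> L1 (fun x => `|f x|).
Proof. by move=> /integrable_norm. Qed.

Lemma L1D f g : L1 f -> L1 g -> L1 (fun x => f x + g x).
Proof. by move=> Lf Lg; have := integrableD measurableT Lf Lg. Qed.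

Lemma L1B f g : L1 f -> L1 g -> L1 (fun x => f x - g x).
Proof. by move=> Lf Lg; have := integrableB measurableT Lf Lg. Qed.

Lemma L1Z k f : L1 f -> L1 (fun x => k * f x).
Proof. by move=> Lf; have := integrableZl measurableT k Lf. Qed.

Lemma eq_L1 f g : f =1 g -> L1 f -> L1 g.
Proof. by move=> /funext ->. Qed.

Lemma RintD f g : L1 f -> L1 g -> \int[mu]_x (f x + g x) = \int[mu]_x f x + \int[mu]_x g x.
Proof. exact: RintegralD. Qed.

Lemma RintB f g : L1 f -> L1 g -> \int[mu]_x (f x - g x) = \int[mu]_x f x - \int[mu]_x g x.
Proof. exact: RintegralB. Qed.

Lemma RintZ k f : L1 f -> \int[mu]_x (k * f x) = k * \int[mu]_x f x.
Proof. exact: RintegralZl. Qed.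

Lemma le_Rint f g : L1 f -> L1 g -> (forall x, f x <= g x) -> \int[mu]_x f x <= \int[mu]_x g x.
Proof. by move=> Lf Lg fg; apply: le_Rintegral. Qed.

Lemma Rint_ge0 f : (forall x, 0 <= f x) -> 0 <= \int[mu]_x f x.
Proof. by move=> f0; apply: Rintegral_ge0. Qed.

Lemma norm_Rint_le f : L1 f -> `|\int[mu]_x f x| <= \int[mu]_x `|f x|.
Proof. by move=> Lf; apply: le_normr_Rintegral. Qed.

Lemma eq_Rint f g : f =1 g -> \int[mu]_x f x = \int[mu]_x g x.
Proof. by move=> /funext ->. Qed.

Lemma RintE f : L1 f -> (\int[mu]_x (f x)%:E)%E = (\int[mu]_x f x)%:E.
Proof. by move=> Lf; rewrite fineK//; exact: integrable_fin_num. Qed.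

(** The reflections x |-> a - x are the only changes of variable needed: they turn
    convolutions around and exchange the two half-lines. *)
Let refl (a : R) : measurableTypeR R -> measurableTypeR R := fun x => a - x.

Let measurable_refl a : measurable_fun setT (refl a).
Proof. by apply: measurable_funB. Qed.

HB.instance Definition _ a :=
  isMeasurableFun.Build _ _ _ _ (refl a) (measurable_refl a).

Let refl_measure a A : measurable A -> pushforward mu (refl a) A = mu A.
Proof.
move=> mA; apply/esym/lebesgue_measure_unique => //= _ [[x b]] _ <-.
rewrite /pushforward.
have -> : refl a @^-1` [set` `]x, b]] = [set` `[a - b, a - x[].
  by apply/seteqP; split=> z; rewrite /refl /= !in_itv/= => /andP[? ?]; apply/andP; split; lra.
rewrite !lebesgue_measure_itv/= !lte_fin.
have -> : (a - b < a - x) = (x < b) by apply/idP/idP; lra.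
by case: ifP => // _; rewrite -!EFinB; congr (_%:E); ring.
Qed.

Lemma integral_refl a (f : R -> \bar R) : measurable_fun setT f ->
  (\int[mu]_x f (a - x)%R = \int[mu]_x f x)%E.
Proof.
have H (g : R -> \bar R) : measurable_fun setT g -> (forall x, (0 <= g x)%E) ->
    (\int[mu]_x g (a - x)%R = \int[mu]_x g x)%E.
  move=> mg g0; transitivity (\int[pushforward mu (refl a)]_x g x)%E.
    by rewrite ge0_integral_pushforward.
  by apply: eq_measure_integral => A mA _; exact: refl_measure.
move=> mf'; rewrite integralE [RHS]integralE.
congr (_ - _)%E.
  by rewrite -[RHS]H//; [|exact: measurable_funepos]; congr (integral _ _ _); apply/funext => x; rewrite !unlock.
by rewrite -[RHS]H//; [|exact: measurable_funeneg]; congr (integral _ _ _); apply/funext => x; rewrite !unlock.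
Qed.

Lemma Rint_refl a f : mf f -> \int[mu]_x f (a - x) = \int[mu]_x f x.
Proof.
move=> /measurable_EFinP mf'.
by have := integral_refl a mf'; rewrite /Rintegral /= => ->.
Qed.

Lemma mf_refl a f : mf f -> mf (fun x => f (a - x)).
Proof. by move=> mf'; apply: (measurableT_comp mf'); exact: measurable_funB. Qed.

Lemma L1_refl a f : L1 f -> L1 (fun x => f (a - x)).
Proof.
move=> /[dup] Lf /integrableP[mf' foo]; have m := L1_mf Lf.
apply: L1P; first exact: mf_refl.
rewrite (@integral_refl a (fun x => `|f x|%:E))//.
by apply/measurable_EFinP; exact: measurableT_comp.
Qed.

Lemma Rint_opp f : mf f -> \int[mu]_x f (- x) = \int[mu]_x f x.
Proof. by move=> /(Rint_refl 0) <-; apply: eq_Rint => x; rewrite sub0r. Qed.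

Lemma L1_opp f : L1 f -> L1 (fun x => f (- x)).
Proof. by move=> /(L1_refl 0); apply: eq_L1 => x; rewrite sub0r. Qed.

Lemma mf_opp f : mf f -> mf (fun x => f (- x)).
Proof. by move=> mf'; apply: (measurableT_comp mf'); exact: oppr_measurable. Qed.

(** Product bounds suffice for the trigonometric and Poisson kernels, which are
    bounded. *)
Lemma fubini_dom (F : R -> R -> R) (a b : R -> R) :
  measurable_fun [set: R * R] (fun p => F p.1 p.2) -> L1 a -> L1 b ->
  (forall x y, `|F x y| <= a x * b y) ->
  L1 (fun x => \int[mu]_y F x y) /\
  \int[mu]_x \int[mu]_y F x y = \int[mu]_y \int[mu]_x F x y.
Proof.
move=> mF La Lb Fab.
have LF1 x : L1 (F x).
  apply: (L1_le _ (L1Z (a x) Lb)) => //.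
  exact: (measurableT_comp mF (measurable_pair1 x)).
have LF2 y : L1 (F^~ y).
  apply: (L1_le _ (L1Z (b y) La)) => [|x]; last by rewrite mulrC.
  exact: (measurableT_comp mF (measurable_pair2 y)).
pose G := fun p : R * R => (F p.1 p.2)%:E.
have mG : measurable_fun [set: measurableTypeR R * measurableTypeR R] G.
  by apply/measurable_EFinP; exact: mF.
have IG : (mu \x mu)%E.-integrable setT G.
  apply/(@integrable12ltyP _ _ _ _ R mu mu G mG).
  apply: (@le_lt_trans _ _ (\int[mu]_x (`|a x| * \int[mu]_y `|b y|)%:E)%E).
    apply: ge0_le_integral => //.
    - by move=> x _; apply: integral_ge0 => y _; exact: abse_ge0.
    - have mG' := measurableT_comp (@abse_measurable R setT) mG.
      exact: (@measurable_fun_fubini_tonelli_F _ _ _ _ R mu _ mG' (fun=> abse_ge0 _)).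
    - apply/measurable_EFinP; apply: measurable_funM => //.
      by apply: measurableT_comp => //; exact: L1_mf.
    move=> x _; rewrite -[leLHS]/(\int[mu]_y `|F x y|%:E)%E.
    rewrite RintE; last exact: L1_norm.
    rewrite lee_fin -RintZ; last exact: L1_norm.
    apply: le_Rint; [exact: L1_norm|by apply: L1Z; exact: L1_norm|].
    by move=> y; rewrite (le_trans (Fab x y))// -normrM ler_norm.
  rewrite RintE ?ltry//.
  by apply: eq_L1 (L1Z (\int[mu]_y `|b y|) (L1_norm La)) => x; rewrite mulrC.
have E1 : (fun x => \int[mu]_y G (x, y))%E = EFin \o (fun x => \int[mu]_y F x y).
  by apply/funext => x; rewrite /= -RintE.
have E2 : (fun y => \int[mu]_x G (x, y))%E = EFin \o (fun y => \int[mu]_x F x y).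
  by apply/funext => y; rewrite /= -RintE.
split.
  by have := integrable_fubini_F IG; rewrite /fubini_F E1.
rewrite /Rintegral; congr fine.
have /= := integral12_prod_meas1 IG; have /= := integral21_prod_meas1 IG.
by rewrite /fubini_F /fubini_G E1 E2 => -> ->.
Qed.

End L1.

(** * Square-integrable functions *)

Section L2.
Context {R : realType}.
Local Notation mu := (@lebesgue_measure R).
Local Notation mf f := (measurable_fun [set: R] (f : R -> R)).
Implicit Types (f g h : R -> R) (P Q : R -> Prop).

Lemma ae_impl P Q : {ae mu, forall x, P x} -> (forall x, P x -> Q x) ->
  {ae mu, forall x, Q x}.
Proof.
move=> [N [mN N0 NP]] PQ; exists N; split=> // x nQ; apply: NP => Px; exact/nQ/PQ.
Qed.

Lemma ae_and P Q : {ae mu, forall x, P x} -> {ae mu, forall x, Q x} ->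
  {ae mu, forall x, P x /\ Q x}.
Proof.
move=> HP HQ; have := @negligibleU _ _ _ mu _ _ HP HQ.
by rewrite -setCI.
Qed.

Lemma ae_all P : (forall x, P x) -> {ae mu, forall x, P x}.
Proof. by move=> HP; exists set0; split=> // x; apply. Qed.

Lemma mf_sqr f : mf f -> mf (fun x => f x ^+ 2).
Proof. exact: measurable_funX. Qed.

Lemma sqnorm_ge0 f : 0 <= sqnorm f.
Proof. by apply: Rint_ge0 => x; exact: sqr_ge0. Qed.

Lemma eq_L2 f g : f =1 g -> L2 f -> L2 g.
Proof. by move=> /funext ->. Qed.

Lemma eq_sqnorm f g : f =1 g -> sqnorm f = sqnorm g.
Proof. by move=> /funext ->. Qed.

Lemma L2_le f g : mf f -> L2 g -> (forall x, `|f x| <= `|g x|) ->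
  L2 f /\ sqnorm f <= sqnorm g.
Proof.
move=> mf' [mg Lg] fg.
have le x : f x ^+ 2 <= g x ^+ 2.
  by rewrite -(real_normK (num_real (f x))) -(real_normK (num_real (g x))) lerXn2r ?nnegrE.
have Lf : L1 (fun x => f x ^+ 2).
  apply: (L1_le (mf_sqr mf') Lg) => x.
  by rewrite ger0_norm ?sqr_ge0.
by split; [split|exact: le_Rint].
Qed.

Lemma L2M f g : L2 f -> L2 g -> L1 (fun x => f x * g x).
Proof.
move=> [mf' Lf] [mg Lg]; apply: (L1_le (measurable_funM mf' mg) (L1D Lf Lg)) => x /=.
rewrite normrM -(real_normK (num_real (f x))) -(real_normK (num_real (g x))).
by have := sqr_ge0 (`|f x| - `|g x|); have := normr_ge0 (f x); have := normr_ge0 (g x); nra.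
Qed.

Lemma L2Z k f : L2 f -> L2 (fun x => k * f x).
Proof.
move=> [mf' Lf]; split; first exact: measurable_funM.
by apply: eq_L1 (L1Z (k ^+ 2) Lf) => x; rewrite exprMn.
Qed.

Lemma sqnormZ k f : L2 f -> sqnorm (fun x => k * f x) = k ^+ 2 * sqnorm f.
Proof.
by move=> [mf' Lf]; rewrite /sqnorm -RintZ//; apply: eq_Rint => x; rewrite exprMn.
Qed.

Lemma L2N f : L2 f -> L2 (fun x => - f x).
Proof. by move=> /(L2Z (-1)); apply: eq_L2 => x; rewrite mulN1r. Qed.

Lemma sqnormN f : sqnorm (fun x => - f x) = sqnorm f.
Proof. by apply: eq_Rint => x; rewrite sqrrN. Qed.

Lemma sqnormBC f g : sqnorm (fun x => f x - g x) = sqnorm (fun x => g x - f x).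
Proof. by apply: eq_Rint => x; rewrite -sqrrN opprB. Qed.

Lemma L2D f g : L2 f -> L2 g -> L2 (fun x => f x + g x).
Proof.
move=> Lf Lg; split; first exact: (measurable_funD Lf.1 Lg.1).
have := L1D (L1D Lf.2 (L1Z 2 (L2M Lf Lg))) Lg.2.
by apply: eq_L1 => x; ring.
Qed.

Lemma L2B f g : L2 f -> L2 g -> L2 (fun x => f x - g x).
Proof. by move=> Lf Lg; exact: (L2D Lf (L2N Lg)). Qed.

Lemma sqnormD f g : L2 f -> L2 g ->
  sqnorm (fun x => f x + g x) <= 2 * sqnorm f + 2 * sqnorm g.
Proof.
move=> Lf Lg; rewrite /sqnorm -(RintZ 2 Lf.2) -(RintZ 2 Lg.2).
rewrite -(RintD (L1Z 2 Lf.2) (L1Z 2 Lg.2)).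
apply: le_Rint; [exact: (L2D Lf Lg).2|by apply: L1D; apply: L1Z; [exact: Lf.2|exact: Lg.2]|].
by move=> x; have := sqr_ge0 (f x - g x); nra.
Qed.

Lemma sqnorm_dist f g h : L2 f -> L2 g -> L2 h ->
  sqnorm (fun x => f x - h x) <=
  2 * sqnorm (fun x => f x - g x) + 2 * sqnorm (fun x => g x - h x).
Proof.
move=> Lf Lg Lh; have := sqnormD (L2B Lf Lg) (L2B Lg Lh).
rewrite (@eq_sqnorm _ (fun x => f x - h x))// => x; ring.
Qed.

(** Young's inequality with a free parameter, a substitute for the
    Cauchy-Schwarz inequality in limit arguments. *)
Lemma young f g s : L2 f -> L2 g -> 0 < s ->
  `|\int[mu]_x (f x * g x)| <= s^-1 * sqnorm f + s * sqnorm g.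
Proof.
move=> Lf Lg s0; apply: (le_trans (norm_Rint_le (L2M Lf Lg))).
have Lf' := L1Z s^-1 Lf.2; have Lg' := L1Z s Lg.2.
rewrite /sqnorm -(RintZ _ Lf.2) -(RintZ _ Lg.2) -(RintD Lf' Lg').
apply: le_Rint; [exact: L1_norm (L2M Lf Lg)|exact: L1D|].
move=> x; rewrite normrM -(real_normK (num_real (f x))) -(real_normK (num_real (g x))).
set a := `|f x|; set b := `|g x|.
have a0 : 0 <= a by exact: normr_ge0.
have b0 : 0 <= b by exact: normr_ge0.
have := sqr_ge0 (a - s * b) => h.
rewrite -subr_ge0.
have -> : s^-1 * a ^+ 2 + s * b ^+ 2 - a * b = s^-1 * ((a - s * b) ^+ 2 + s * (a * b)).
  by field; rewrite gt_eqF.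
have s0' := ltW s0.
by rewrite mulr_ge0 ?invr_ge0// addr_ge0// mulr_ge0// mulr_ge0.
Qed.

Lemma cvg0_le (u v : nat -> R) : (forall n, 0 <= u n) -> (forall n, u n <= v n) ->
  v @ \oo --> 0 -> u @ \oo --> 0.
Proof.
move=> u0 uv v0; apply: (squeeze_cvgr _ (cvg_cst 0) v0).
by apply: nearW => n; rewrite u0 uv.
Qed.

Lemma cvg_inner (F : nat -> R -> R) f g : (forall k, L2 (F k)) -> L2 f -> L2 g ->
  sqnorm (fun x => F k x - f x) @[k --> \oo] --> 0 ->
  \int[mu]_x (F k x * g x) @[k --> \oo] --> \int[mu]_x (f x * g x).
Proof.
move=> LF Lf Lg F0; apply/cvgrPdist_lt => e e0.
have s0 : 0 < e / (2 * (sqnorm g + 1)).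
  by have := sqnorm_ge0 g => g0; rewrite divr_gt0// mulr_gt0//; lra.
set s := e / _ in s0.
have sg : s * sqnorm g < e / 2.
  have := sqnorm_ge0 g => g0; rewrite -subr_gt0.
  suff -> : e / 2 - s * sqnorm g = s by [].
  by rewrite /s; field; lra.
have e4 : 0 < s * (e / 2) by rewrite mulr_gt0// divr_gt0.
move/cvgrPdist_lt : F0 => /(_ _ e4); apply: filterS => k.
rewrite sub0r normrN ger0_norm ?sqnorm_ge0// => Fk.
rewrite distrC -RintB; [|exact: L2M|exact: L2M].
under eq_Rintegral do rewrite -mulrBl.
apply: (le_lt_trans (young (L2B (LF k) Lf) Lg s0)).
have : s^-1 * sqnorm (fun x => F k x - f x) < e / 2.
  by rewrite mulrC ltr_pdivrMr// mulrC.
lra.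
Qed.

Lemma dct_L1 (F : nat -> R -> R) f g : (forall k, mf (F k)) -> mf f -> L1 g ->
  (forall k x, `|F k x| <= g x) -> (forall x, F^~ x @ \oo --> f x) ->
  \int[mu]_x F k x @[k --> \oo] --> \int[mu]_x f x.
Proof.
move=> mF mf' Lg Fg Ff.
have [||||Lf _ H] := @dominated_convergence _ _ _ mu setT measurableT
   (fun k x => (F k x)%:E) (EFin \o f) (EFin \o g) _ _ _ Lg _.
- by move=> k; apply/measurable_EFinP; exact: mF.
- by apply/measurable_EFinP.
- by apply: ae_all => x _; apply: cvg_EFin; [exact: nearW|exact: Ff].
- by apply: ae_all => x k _; rewrite lee_fin.
move: H; rewrite [X in _ --> X]RintE; last exact: Lf.
exact: fine_cvg.
Qed.

Lemma dct_L2 (F : nat -> R -> R) f g : (forall k, mf (F k)) -> mf f -> L2 g ->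
  (forall k x, `|F k x| <= `|g x|) -> (forall x, F^~ x @ \oo --> f x) ->
  sqnorm (fun x => F k x - f x) @[k --> \oo] --> 0.
Proof.
move=> mF mf' Lg Fg Ff.
have fg x : `|f x| <= `|g x|.
  have h : `|F k x| @[k --> \oo] --> `|f x| by apply: cvg_norm; exact: Ff.
  rewrite -(cvg_lim _ h)//.
  by apply: limr_le; [apply/cvg_ex; eexists; exact: h|exact: nearW].
have -> : 0 = \int[mu]_x (cst 0 x) :> R by rewrite Rintegral_cst// mul0r.
apply: (dct_L1 (g := fun x => 4 * g x ^+ 2)) => //.
- by move=> k; apply: mf_sqr; exact: measurable_funB.
- exact: L1Z Lg.2.
- move=> k x; rewrite ger0_norm ?sqr_ge0//.
  rewrite -(real_normK (num_real (F k x - _))) -(real_normK (num_real (g x))).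
  have : `|F k x - f x| <= 2 * `|g x|.
    by rewrite (le_trans (ler_normB _ _))// mulr_natl mulr2n lerD.
  by have := normr_ge0 (F k x - f x); nra.
move=> x; rewrite -[cst 0 x](expr0n _ 2) -(subrr (f x)).
by apply: cvgM; apply: cvgB => //; exact: cvg_cst.
Qed.

Lemma fatou_L2 (F : nat -> R -> R) f M : (forall k, L2 (F k)) -> mf f ->
  {ae mu, forall x, F^~ x @ \oo --> f x} -> (forall k, sqnorm (F k) <= M) ->
  L2 f /\ sqnorm f <= M.
Proof.
move=> LF mf' Ff FM.
have key : (\int[mu]_x (f x ^+ 2)%:E <= M%:E)%E.
  have fat := @fatou _ _ _ mu setT measurableT (fun k x => (F k x ^+ 2)%:E) _ _.
  apply: (@le_trans _ _ (limn_einf (fun k => \int[mu]_x (F k x ^+ 2)%:E)%E)).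
    apply: le_trans (fat _ _); last 2 first.
      by move=> k; apply/measurable_EFinP; exact: mf_sqr (LF k).1.
      by move=> k x _; rewrite lee_fin sqr_ge0.
    apply: ae_ge0_le_integral => //.
    - by move=> x _; rewrite lee_fin sqr_ge0.
    - by apply/measurable_EFinP; exact: mf_sqr.
    - move=> x _; rewrite limn_einf_lim; apply: lime_ge; first exact: is_cvg_einfs.
      by apply: nearW => n; apply: le_ereal_inf_tmp => _ [k _ <-]; rewrite lee_fin sqr_ge0.
    - have -> : (fun x => limn_einf ((fun k x => (F k x ^+ 2)%:E) ^~ x)) =
        (fun x => - limn_esup (fun k => - (F k x ^+ 2)%:E))%E.
        by apply/funext => x; rewrite -limn_einfN; congr limn_einf; apply/funext => k /=; rewrite opprK.
      apply: measurableT_comp => //; apply: measurable_fun_limn_esup => k.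
      by apply: measurableT_comp => //; apply/measurable_EFinP; exact: mf_sqr (LF k).1.
    apply: (ae_impl Ff) => x Fx _.
    have h : (F k x ^+ 2)%:E @[k --> \oo] --> (f x ^+ 2)%:E.
      by apply: cvg_EFin; [exact: nearW|exact: cvgM].
    by rewrite (cvg_limn_einf_sup h).1.
  rewrite limn_einf_lim; apply: lime_le; first exact: is_cvg_einfs.
  apply: nearW => n; apply: (@le_trans _ _ (\int[mu]_x (F n x ^+ 2)%:E)%E).
    by apply: ereal_inf_lbound; exists n => /=.
  by rewrite (RintE (LF n).2) lee_fin; exact: FM.
have Lf : L1 (fun x => f x ^+ 2).
  apply: L1P; first exact: mf_sqr.
  under eq_integral do rewrite ger0_norm ?sqr_ge0//.
  by rewrite (le_lt_trans key)// ltry.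
by split; [split|rewrite -lee_fin -(RintE Lf)].
Qed.

Lemma sqnorm_eq0 f : L2 f -> sqnorm f = 0 -> {ae mu, forall x, f x = 0}.
Proof.
move=> Lf f0.
have [H _] := @ae_eq_integral_abs _ _ _ mu setT measurableT (fun x => (f x ^+ 2)%:E) (measurable_int mu Lf.2).
have : ae_eq mu setT (fun x => (f x ^+ 2)%:E) (cst 0%E).
  apply: H; transitivity (\int[mu]_x (f x ^+ 2)%:E)%E.
    by apply: eq_integral => x _; rewrite gee0_abs// lee_fin sqr_ge0.
  by rewrite (RintE Lf.2) -/(sqnorm f) f0.
by move=> h0; apply: (ae_impl h0) => x /(_ I) [] /eqP; rewrite sqrf_eq0 => /eqP.
Qed.

End L2.

(** * Truncation and completeness *)

Section RieszFischer.
Context {R : realType}.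
Local Notation mu := (@lebesgue_measure R).
Local Notation mf f := (measurable_fun [set: R] (f : R -> R)).
Implicit Types (f g h : R -> R).

Definition trunc (n : nat) f : R -> R := fun x => f x * \1_`[- n%:R, n%:R] x.

Lemma indic_L2 (a b : R) : L2 (\1_`[a, b] : R -> R).
Proof.
split; first exact: measurable_indic.
apply: eq_L1 (integrable_indic_itv a b true false) => x.
by rewrite indicE; case: (_ \in _); rewrite ?expr1n ?expr0n.
Qed.

Lemma trunc_mf n f : mf f -> mf (trunc n f).
Proof. by move=> mf'; apply: measurable_funM => //; exact: measurable_indic. Qed.

Lemma trunc_le n f x : `|trunc n f x| <= `|f x|.
Proof.
rewrite /trunc normrM indicE; case: (_ \in _); first by rewrite normr1 mulr1.
by rewrite normr0 mulr0.
Qed.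

Lemma trunc_L2 n f : L2 f -> L2 (trunc n f).
Proof.
by move=> Lf; apply: (L2_le (trunc_mf n Lf.1) Lf (trunc_le n f)).1.
Qed.

Lemma trunc_sqnorm n f : L2 f -> sqnorm (trunc n f) <= sqnorm f.
Proof.
by move=> Lf; apply: (L2_le (trunc_mf n Lf.1) Lf (trunc_le n f)).2.
Qed.

Lemma trunc_L1 n f : L2 f -> L1 (trunc n f).
Proof. by move=> Lf; exact: (L2M Lf (indic_L2 _ _)). Qed.

Lemma trunc_cvg f : L2 f -> sqnorm (fun x => trunc n f x - f x) @[n --> \oo] --> 0.
Proof.
move=> Lf; apply: (dct_L2 _ Lf.1 Lf) => [k|k x|x].
- exact: trunc_mf Lf.1.
- exact: trunc_le.
apply: cvg_near_cst; near=> n.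
rewrite /trunc indicE mem_set ?mulr1//= in_itv/= -ler_norml.
by near: n; exact: nbhs_infty_ger.
Unshelve. all: by end_near. Qed.

(** Along a subsequence whose increments d_k satisfy
    sqnorm d_k <= 4^-k 2^-(k+1), the sum of 4^k d_k^2 has a finite integral, so it is
    finite almost everywhere and there |d_k| decays geometrically. The limit along the
    subsequence is the limit in mean by Fatou's lemma. *)
Lemma riesz_fischer (F : nat -> R -> R) : (forall k, L2 (F k)) ->
  (forall e, 0 < e -> exists N, forall m n, (N <= m)%N -> (N <= n)%N ->
     sqnorm (fun x => F m x - F n x) <= e) ->
  exists f, L2 f /\ sqnorm (fun x => F n x - f x) @[n --> \oo] --> 0.
Proof.
move=> LF cau.
pose eps (k : nat) : R := (4 ^+ k)^-1 * (1 / (2 ^ k.+1)%:R).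
have eps0 k : 0 < eps k by rewrite mulr_gt0// ?invr_gt0 ?exprn_gt0// divr_gt0// ltr0n expn_gt0.
have [N HN] := choice (fun k => cau (eps k) (eps0 k)).
pose n k := (k + \sum_(i < k.+1) N i)%N.
have nN k : (N k <= n k)%N by rewrite /n big_ord_recr/= addnA leq_addl.
have nS k : (n k <= n k.+1)%N by rewrite /n leq_add// [X in (_ <= X)%N]big_ord_recr/= leq_addr.
pose d k := fun x => F (n k.+1) x - F (n k) x.
have Ld k : L2 (d k) by exact: L2B.
have dk k : sqnorm (d k) <= eps k.
  by apply: HN; [exact: leq_trans (nN k) (nS k)|exact: nN].
pose g k := fun x => 4 ^+ k * d k x ^+ 2.
have g0 k x : 0 <= g k x by rewrite mulr_ge0 ?sqr_ge0// exprn_ge0.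
have Lg k : L1 (g k) by exact: L1Z (Ld k).2.
pose G x := (\sum_(0 <= k <oo) (g k x)%:E)%E.
have mg k : measurable_fun setT (fun x => (g k x)%:E) by apply/measurable_EFinP; exact: L1_mf (Lg k).
have mG : measurable_fun setT G by apply: ge0_emeasurable_sum => // k x _ _; rewrite lee_fin.
have G0 x : (0 <= G x)%E by apply: nneseries_ge0 => k _ _; rewrite lee_fin.
have Goo : (\int[mu]_x G x < +oo)%E.
  rewrite integral_nneseries//; last by move=> k x _; rewrite lee_fin.
  apply: (@le_lt_trans _ _ (\sum_(0 <= k <oo) (1 / (2 ^ k.+1)%:R)%:E)%E); last first.
    by apply: (le_lt_trans (epsilon_trick0 xpredT ler01)); rewrite ltry.
  apply: lee_nneseries => [k _ _|k _].
    by apply: integral_ge0 => x _; rewrite lee_fin.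
  rewrite (RintE (Lg k)) lee_fin /g (RintZ _ (Ld k).2).
  by rewrite -ler_pdivlMl ?exprn_gt0//; exact: dk.
have Gfin : {ae mu, forall x, G x \is a fin_num}.
  have IG : mu.-integrable setT G.
    apply/integrableP; split=> //.
    by under eq_integral do rewrite gee0_abs//.
  by have h := integrable_ae measurableT IG; apply: (ae_impl h) => x; exact.
have Fcvg : {ae mu, forall x, cvgn (fun k => F (n k) x)}.
  apply: (ae_impl Gfin) => x Gx.
  have dle k : `|d k x| <= geometric (Num.sqrt (fine (G x))) (2^-1) k.
    have h : g k x <= fine (G x).
      rewrite -lee_fin fineK//.
      have := @nneseries_lim_ge _ (fun k => (g k x)%:E) xpredT 0%N k.+1.
      move=> /(_ (fun k _ _ => g0 k x)).
      apply: le_trans; rewrite big_nat_recr//= leeDr//.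
      by apply: sume_ge0 => i _; rewrite lee_fin.
    rewrite /geometric /= -sqrtr_sqr.
    have -> : 2^-1 ^+ k = Num.sqrt ((4 ^+ k)^-1) :> R.
      rewrite -[LHS]ger0_norm ?exprn_ge0// -sqrtr_sqr; congr (Num.sqrt _).
      by rewrite -exprM mulnC exprM -exprVn; congr (_ ^+ k); field.
    rewrite -sqrtrM ?fine_ge0// ler_wsqrtr//.
    by rewrite ler_pdivlMr ?exprn_gt0// mulrC.
  have : cvgn (series (d^~ x)).
    apply: normed_cvg; apply: series_le_cvg dle _ => //.
      by move=> k; rewrite mulr_ge0 ?sqrtr_ge0 ?exprn_ge0.
    by apply: is_cvg_geometric_series; rewrite ger0_norm//; lra.
  have E : (fun k => F (n k) x) = (fun k => F (n 0%N) x + series (d^~ x) k).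
    apply/funext => k; rewrite /series /= (telescope_sumr (fun k => F (n k) x))//.
    by ring.
  by move=> h; rewrite E; apply: is_cvgD => //; exact: is_cvg_cst.
pose f x := fine (limn_esup (fun k => (F (n k) x)%:E)).
have mf' : mf f.
  apply: (@measurableT_comp _ _ _ _ _ _ fine); first exact: fine_measurable.
  by apply: measurable_fun_limn_esup => k; apply/measurable_EFinP; exact: (LF _).1.
have Ff : {ae mu, forall x, (fun k => F (n k) x) @ \oo --> f x}.
  apply: (ae_impl Fcvg) => x /cvg_ex[l Fl].
  suff -> : f x = l by [].
  have h : (F (n k) x)%:E @[k --> \oo] --> l%:E.
    by apply: cvg_EFin; [exact: nearW|exact: Fl].
  by rewrite /f (cvg_limn_einf_sup h).2.
have key e : 0 < e -> exists K, forall m, (K <= m)%N ->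
    L2 (fun x => F m x - f x) /\ sqnorm (fun x => F m x - f x) <= e.
  move=> e0; have [K HK] := cau e e0; exists K => m Km.
  apply: (@fatou_L2 _ (fun k x => F m x - F (n (k + K)%N) x)).
  - by move=> k; exact: L2B.
  - by apply: measurable_funB => //; exact: (LF m).1.
  - apply: (ae_impl Ff) => x Fx; apply: cvgB; first exact: cvg_cst.
    by rewrite (cvg_shiftn K (fun k => F (n k) x)).
  move=> k; apply: HK => //.
  by rewrite /n (leq_trans (leq_addl k K))// leq_addr.
have Lf : L2 f.
  have [K /(_ K (leqnn K)) [LK _]] := key 1 ltr01.
  by apply: eq_L2 (L2B (LF K) LK) => x; ring.
exists f; split=> //; apply/cvgrPdist_le => e e0.
have [K HK] := key e e0; exists K => // m /= Km.
by rewrite sub0r normrN ger0_norm ?sqnorm_ge0//; exact: (HK m Km).2.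
Qed.

End RieszFischer.

(** * Laplace transforms of bounded functions *)

Section Kernels.
Context {R : realType}.
Local Notation mu := (@lebesgue_measure R).
Local Notation mf f := (measurable_fun [set: R] (f : R -> R)).
Implicit Types (f g h c C : R -> R) (e u M K : R).

Lemma expR_decay e : 0 < e -> expR (- (e * w)) @[w --> +oo] --> 0.
Proof.
move=> e0; apply: (@cvg_comp _ _ _ (fun w => e * w) (fun x => expR (- x)) _ +oo); last exact: cvgr_expR.
by apply: gt0_cvgMry => //; exact: cvg_id.
Qed.

(** Since C' = e C + c, the function exp(-e w) C(w) is an antiderivative of the
    integrand; it vanishes at infinity because C is bounded. *)
Lemma half_laplace_ge0 e c C M : 0 < e -> (forall w : R, is_derive w 1 C (e * C w + c w)) ->
  continuous c -> (forall w, 0 <= c w) -> (forall w, `|C w| <= M) ->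
  (\int[mu]_(w in `[0%R, +oo[) (expR (- (e * w)) * c w)%:E = (- C 0%R)%:E)%E.
Proof.
move=> e0 dC cc c0 CM.
pose F w := expR (- (e * w)) * C w.
have dE (w : R) : is_derive w 1 (fun w => expR (- (e * w))) (expR (- (e * w)) * - e).
  apply: (@is_derive1_comp _ expR (fun w => - (e * w))).
  by apply: is_deriveN; apply: is_derive_eq; rewrite /GRing.scale/=; ring.
have dF (w : R) : is_derive w 1 F (expR (- (e * w)) * c w).
  have -> : expR (- (e * w)) * c w = expR (- (e * w)) *: (e * C w + c w) + C w *: (expR (- (e * w)) * - e).
    by rewrite /GRing.scale/=; ring.
  exact: (is_deriveM (dE w) (dC w)).
have cE (w : R) : {for w, continuous (fun w => expR (- (e * w)))}.
  by apply/differentiable_continuous/derivable1_diffP; have := dE w => -[].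
have cF (w : R) : {for w, continuous F}.
  by apply/differentiable_continuous/derivable1_diffP; have := dF w => -[].
rewrite (@ge0_continuous_FTC2y _ _ F 0 0).
- by rewrite /F mulr0 oppr0 expR0 mul1r sub0e.
- by move=> w _; rewrite mulr_ge0// expR_ge0.
- apply: continuous_subspaceT => w; by apply: cvgM; [exact: cE|exact: cc].
- have h : expR (- (e * w)) * M @[w --> +oo] --> 0.
    by rewrite -(mul0r M); apply: cvgM; [exact: expR_decay|exact: cvg_cst].
  have h' : - (expR (- (e * w)) * M) @[w --> +oo] --> 0 by rewrite -oppr0; exact: cvgN.
  apply: (squeeze_cvgr _ h' h); apply: nearW => w.
  rewrite -ler_norml normrM (ger0_norm (expR_ge0 _)).
  by rewrite ler_wpM2l ?expR_ge0.
- by move=> w _; have := dF w => -[].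
- by apply: cvg_at_right_filter; exact: cF.
- by move=> w _; rewrite derive1E; have := dF w => -[].
Qed.

Local Notation D := (`[0, +oo[%classic : set R).

Lemma ge0_integrable (f : R -> R) (l : R) : measurable_fun D f ->
  (forall w, D w -> 0 <= f w) -> (\int[mu]_(w in D) (f w)%:E)%E = l%:E ->
  mu.-integrable D (EFin \o f) /\ \int[mu]_(w in D) f w = l.
Proof.
move=> mf' f0 fl; split; last by rewrite /Rintegral fl.
apply/integrableP; split; first exact/measurable_EFinP.
rewrite (_ : (\int[mu]_(w in D) _)%E = l%:E) ?ltry// -fl.
by apply: eq_integral => w; rewrite inE => Dw; rewrite gee0_abs// lee_fin f0.
Qed.

Lemma mf_expM e : mf (fun w => expR (- (e * w))).
Proof.
apply: (measurableT_comp (@measurable_expR R)).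
by apply: measurable_funN; exact: mulrl_measurable.
Qed.

(** The integrand may change sign: subtract the integrals for the nonnegative
    functions K + c and K. *)
Lemma half_laplace e c C K M : 0 < e -> (forall w : R, is_derive w 1 C (e * C w + c w)) ->
  continuous c -> (forall w, `|c w| <= K) -> (forall w, `|C w| <= M) ->
  mu.-integrable D (EFin \o (fun w => expR (- (e * w)) * c w)) /\
  \int[mu]_(w in D) (expR (- (e * w)) * c w) = - C 0.
Proof.
move=> e0 dC cc cK CM.
have mc c' : continuous c' -> measurable_fun D (fun w => expR (- (e * w)) * c' w).
  move=> cc'; apply: (measurable_funS measurableT) => //.
  by apply: measurable_funM; [exact: mf_expM|exact: continuous_measurable_fun].
have K0 : 0 <= K by exact: le_trans (cK 0).
have [I1 E1] : mu.-integrable D (EFin \o (fun w => expR (- (e * w)) * K)) /\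
  \int[mu]_(w in D) (expR (- (e * w)) * K) = K / e.
  apply: ge0_integrable; first by apply: mc => w; exact: cvg_cst.
    by move=> w _; rewrite mulr_ge0// expR_ge0.
  have dC1 (w : R) : is_derive w 1 (fun=> - (K / e) : R) (e * - (K / e) + K).
    by apply: is_derive_eq; field; rewrite gt_eqF.
  rewrite (half_laplace_ge0 (c := fun=> K) (M := K / e) e0 dC1)//.
  - by rewrite opprK.
  - by move=> w; exact: cvg_cst.
  - by move=> w; rewrite normrN ger0_norm// divr_ge0// ltW.
have [I2 E2] : mu.-integrable D (EFin \o (fun w => expR (- (e * w)) * (K + c w))) /\
  \int[mu]_(w in D) (expR (- (e * w)) * (K + c w)) = K / e - C 0.
  apply: ge0_integrable.
  - by apply: mc => w; apply: cvgD; [exact: cvg_cst|exact: cc].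
  - move=> w _; rewrite mulr_ge0 ?expR_ge0//.
    by have := cK w; rewrite ler_norml => /andP[h _]; lra.
  have dC2 (w : R) : is_derive w 1 (fun w => C w - K / e) (e * (C w - K / e) + (K + c w)).
    have := is_deriveB (dC w) (is_derive_cst (K / e) w 1).
    rewrite (_ : _ - 0 = e * (C w - K / e) + (K + c w))//.
    by rewrite subr0 mulrBr; field; rewrite gt_eqF.
  rewrite (half_laplace_ge0 (c := fun w => K + c w) (M := M + K / e) e0 dC2).
  - by rewrite opprB.
  - by move=> w; apply: cvgD; [exact: cvg_cst|exact: cc].
  - by move=> w; have := cK w; rewrite ler_norml => /andP[h _]; lra.
  - by move=> w; rewrite (le_trans (ler_normB _ _))// lerD// ger0_norm// divr_ge0//; exact: ltW.
have E (t : R) : expR (- (e * t)) * c t = expR (- (e * t)) * (K + c t) - expR (- (e * t)) * K.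
  by ring.
split.
  rewrite (_ : EFin \o _ = (fun t => (expR (- (e * t)) * (K + c t))%:E -
     (expR (- (e * t)) * K)%:E)%E); first exact: integrableB.
  by apply/funext => t /=; rewrite E EFinB.
under eq_Rintegral do rewrite E.
by rewrite RintegralB// E1 E2; ring.
Qed.

Lemma Rint_half g : L1 g -> \int[mu]_x g x = \int[mu]_(x in D) (g x + g (- x)).
Proof.
move=> Lg; have mg := L1_mf Lg.
have LD : mu.-integrable D (EFin \o g) by apply: integrableS Lg.
have LDN : mu.-integrable D (EFin \o (fun x => g (- x))) by apply: integrableS (L1_opp Lg).
rewrite RintegralD//.
pose D' := (`]-oo, 0[%classic : set R).
have LD' : mu.-integrable D' (EFin \o g) by rewrite /D'; apply: integrableS Lg.
have mD' : measurable D' by rewrite /D'.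
have DU : D `|` D' = setT.
  by apply/seteqP; split=> // x _; rewrite /D' /= !in_itv/= andbT; case: (leP 0 x); [left|right].
rewrite -[in LHS]DU Rintegral_setU//; last 2 first.
- by rewrite DU.
- apply/disj_setPS => x []; rewrite /= !in_itv/= andbT => x0 x1.
  by move: (le_lt_trans x0 x1); rewrite ltxx.
congr (_ + _).
rewrite Rintegral_mkcond -Rint_opp; last first.
  by apply: (measurable_restrictT _ _).1 => //; apply: measurable_funS mg.
rewrite -(@Rintegral_itv_obnd_cbnd _ 0 +oo%O)//; last first.
  by apply: integrableS (L1_opp Lg).
rewrite [RHS]Rintegral_mkcond; apply: eq_Rint => x.
by rewrite !patchE !mem_setE !in_itv/= andbT oppr_lt0.
Qed.

(** The factor of Abel summation. *)
Definition abel e (w : R) : R := expR (- (e * `|w|)).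

Lemma abel_ge0 e w : 0 <= abel e w. Proof. exact: expR_ge0. Qed.

Lemma abelN e w : abel e (- w) = abel e w. Proof. by rewrite /abel normrN. Qed.

Lemma abel_le1 e w : 0 <= e -> abel e w <= 1.
Proof. by move=> e0; rewrite /abel -expR0 ler_expR oppr_le0 mulr_ge0. Qed.

Lemma mf_abel e : mf (abel e).
Proof.
apply: (measurableT_comp (@measurable_expR R)); apply: measurable_funN.
by apply: measurable_funM => //; exact: normr_measurable.
Qed.

Lemma abel_L1 e : 0 < e -> L1 (abel e).
Proof.
move=> e0.
have [I1 _] : mu.-integrable D (EFin \o (fun w => expR (- (e * w)) * 1)) /\
    \int[mu]_(w in D) (expR (- (e * w)) * 1) = - (- (1 / e)).
  have dC (w : R) : is_derive w 1 (fun=> - (1 / e) : R) (e * - (1 / e) + 1).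
    by apply: is_derive_eq; field; rewrite gt_eqF.
  apply: (half_laplace (c := fun=> 1) (K := 1) (M := 1 / e) e0 dC).
  - by move=> w; exact: cvg_cst.
  - by move=> w; rewrite normr1.
  - by move=> w; rewrite normrN ger0_norm// divr_ge0// ltW.
have mD : measurable D by exact: measurable_itv.
have h : L1 ((fun w => expR (- (e * w)) * 1) \_ D).
  have := (@integrable_mkcond _ _ R mu D (EFin \o (fun w => expR (- (e * w)) * 1)) mD).1 I1.
  by rewrite restrict_EFin.
apply: (L1_le (mf_abel e) (L1D h (L1_opp h))) => w.
rewrite ger0_norm ?abel_ge0// !patchE !mem_setE !in_itv/= !andbT !mulr1 /abel.
have p0 (x : R) : 0 <= expR x by exact: expR_ge0.
case: (ger0P w) => [w0|w0].
  by case: ifP => _; rewrite lerDl.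
by rewrite oppr_ge0 (ltW w0) lerDr.
Qed.

Lemma abel_L2 e : 0 < e -> L2 (abel e).
Proof.
move=> e0; split; first exact: mf_abel.
have e20 : 0 < e * 2 by rewrite mulr_gt0.
apply: eq_L1 (abel_L1 e20) => w.
by rewrite /abel -expRM_natl; congr expR; ring.
Qed.

End Kernels.

(** * Abel means of cosine and sine, and the Poisson kernel *)

Section AbelIntegrals.
Context {R : realType}.
Local Notation mu := (@lebesgue_measure R).
Local Notation mf f := (measurable_fun [set: R] (f : R -> R)).
Local Notation D := (`[0, +oo[%classic : set R).
Implicit Types (f g h c C : R -> R) (e u M K : R).

(** The value 1 at 0 makes the square of sgm equal to 1 everywhere. *)
Definition sgm (w : R) : R := if w < 0 then -1 else 1.

(** Without the customary factor 1/pi, so that the integral is pi. *)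
Definition poisson e (u : R) : R := e / (e ^+ 2 + u ^+ 2).

Let q_gt0 e u : 0 < e -> 0 < e ^+ 2 + u ^+ 2.
Proof. by move=> e0; rewrite ltr_wpDr ?sqr_ge0 ?exprn_gt0. Qed.

Lemma mf_sgm : mf sgm.
Proof.
rewrite /sgm; apply: measurable_fun_ifT => //.
exact: measurable_fun_ltr.
Qed.

Lemma sgmN w : w != 0 -> sgm (- w) = - sgm w.
Proof.
rewrite /sgm oppr_lt0 => w0; case: (ltgtP w 0) => //.
- by rewrite opprK.
- by move=> wE; rewrite wE eqxx in w0.
Qed.

Lemma sgm_norm w : `|sgm w| = 1.
Proof. by rewrite /sgm; case: ifP; rewrite ?normrN normr1. Qed.

Lemma is_derive_sinM u (w : R) : is_derive w 1 (fun w => sin (w * u)) (u * cos (w * u)).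
Proof.
have h : is_derive w 1 (fun w => w * u) u by apply: is_derive_eq; rewrite /GRing.scale/=; ring.
by rewrite mulrC; exact: (@is_derive1_comp _ sin (fun w => w * u)).
Qed.

Lemma is_derive_cosM u (w : R) : is_derive w 1 (fun w => cos (w * u)) (- (u * sin (w * u))).
Proof.
have h : is_derive w 1 (fun w => w * u) u by apply: is_derive_eq; rewrite /GRing.scale/=; ring.
by rewrite -mulrN mulrC; exact: (@is_derive1_comp _ cos (fun w => w * u)).
Qed.

Lemma cont_sinM u : continuous (fun w : R => sin (w * u)).
Proof.
move=> w; apply/differentiable_continuous/derivable1_diffP.
by have := is_derive_sinM u w => -[].
Qed.

Lemma cont_cosM u : continuous (fun w : R => cos (w * u)).
Proof.
move=> w; apply/differentiable_continuous/derivable1_diffP.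
by have := is_derive_cosM u w => -[].
Qed.

Lemma mf_sinM u : mf (fun w => sin (w * u)).
Proof. exact: continuous_measurable_fun (cont_sinM (u := u)). Qed.

Lemma mf_cosM u : mf (fun w => cos (w * u)).
Proof. exact: continuous_measurable_fun (cont_cosM (u := u)). Qed.

Let lin_bound (a b x y : R) : `|x| <= 1 -> `|y| <= 1 -> `|a * x + b * y| <= `|a| + `|b|.
Proof.
move=> x1 y1; rewrite (le_trans (ler_normD _ _))// !normrM.
by apply: lerD; rewrite ler_piMr.
Qed.

Let half_cos e u : 0 < e ->
  mu.-integrable D (EFin \o (fun w => expR (- (e * w)) * cos (w * u))) /\
  \int[mu]_(w in D) (expR (- (e * w)) * cos (w * u)) = e / (e ^+ 2 + u ^+ 2).
Proof.
move=> e0; have q0 := q_gt0 u e0; set q := _ + _ in q0 *.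
have dC (w : R) : is_derive w 1 (fun w => u / q * sin (w * u) + - (e / q) * cos (w * u))
   (e * (u / q * sin (w * u) + - (e / q) * cos (w * u)) + cos (w * u)).
  have -> : e * (u / q * sin (w * u) + - (e / q) * cos (w * u)) + cos (w * u) =
      u / q * (u * cos (w * u)) + - (e / q) * (- (u * sin (w * u))).
    by rewrite /q; field; rewrite gt_eqF.
  exact: (is_deriveD (is_deriveZ (u / q) (is_derive_sinM u w))
                     (is_deriveZ (- (e / q)) (is_derive_cosM u w))).
have [h ->] := half_laplace e0 dC (cont_cosM (u := u)) (K := 1) (M := `|u / q| + `| - (e / q)|)
   (fun w => cos_max _) (fun w => lin_bound _ _ (sin_max _) (cos_max _)).
by split=> //; rewrite mul0r sin0 cos0; ring.
Qed.

Let half_sin e u : 0 < e ->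
  mu.-integrable D (EFin \o (fun w => expR (- (e * w)) * sin (w * u))) /\
  \int[mu]_(w in D) (expR (- (e * w)) * sin (w * u)) = u / (e ^+ 2 + u ^+ 2).
Proof.
move=> e0; have q0 := q_gt0 u e0; set q := _ + _ in q0 *.
have dC (w : R) : is_derive w 1 (fun w => - (e / q) * sin (w * u) + - (u / q) * cos (w * u))
   (e * (- (e / q) * sin (w * u) + - (u / q) * cos (w * u)) + sin (w * u)).
  have -> : e * (- (e / q) * sin (w * u) + - (u / q) * cos (w * u)) + sin (w * u) =
      - (e / q) * (u * cos (w * u)) + - (u / q) * (- (u * sin (w * u))).
    by rewrite /q; field; rewrite gt_eqF.
  exact: (is_deriveD (is_deriveZ (- (e / q)) (is_derive_sinM u w))
                     (is_deriveZ (- (u / q)) (is_derive_cosM u w))).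
have [h ->] := half_laplace e0 dC (cont_sinM (u := u)) (K := 1) (M := `|- (e / q)| + `| - (u / q)|)
   (fun w => sin_max _) (fun w => lin_bound _ _ (sin_max _) (cos_max _)).
by split=> //; rewrite mul0r sin0 cos0; ring.
Qed.

Lemma abelM_L1 e g : 0 < e -> mf g -> (forall w, `|g w| <= 1) -> L1 (fun w => abel e w * g w).
Proof.
move=> e0 mg g1; apply: (L1_le _ (abel_L1 e0)) => [|w].
  by apply: measurable_funM => //; exact: mf_abel.
by rewrite normrM (ger0_norm (abel_ge0 _ _)) ler_piMr ?abel_ge0.
Qed.

Lemma int_abel_cos e u : 0 < e ->
  \int[mu]_w (abel e w * cos (w * u)) = 2 * poisson e u.
Proof.
move=> e0; rewrite Rint_half; last by apply: abelM_L1 => // [|w]; [exact: mf_cosM|exact: cos_max].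
have [h hE] := half_cos u e0; rewrite /poisson -hE -RintegralZl//.
apply: eq_Rintegral => w; rewrite inE /= in_itv/= andbT => w0.
by rewrite abelN mulNr cosN /abel ger0_norm//; ring.
Qed.

Lemma sgm_abel_sin_L1 e u : 0 < e -> L1 (fun w => sgm w * abel e w * sin (w * u)).
Proof.
move=> e0; apply: (@eq_L1 _ (fun w => abel e w * (sgm w * sin (w * u)))) => [w|]; first by ring.
apply: abelM_L1 => // [|w]; first by apply: measurable_funM; [exact: mf_sgm|exact: mf_sinM].
by rewrite normrM sgm_norm mul1r sin_max.
Qed.

Lemma int_abel_sin e u : 0 < e ->
  \int[mu]_w (sgm w * abel e w * sin (w * u)) = 2 * (u / (e ^+ 2 + u ^+ 2)).
Proof.
move=> e0; rewrite Rint_half; last exact: sgm_abel_sin_L1.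
have [h <-] := half_sin u e0; rewrite -RintegralZl//.
apply: eq_Rintegral => w; rewrite inE /= in_itv/= andbT => w0.
have [->|wN0] := eqVneq w 0; first by rewrite oppr0 mul0r sin0 !mulr0 addr0.
rewrite sgmN// abelN !mulNr sinN /abel ger0_norm// /sgm ltNge w0/=; ring.
Qed.

Lemma poisson_ge0 e u : 0 <= e -> 0 <= poisson e u.
Proof. by move=> e0; rewrite divr_ge0// addr_ge0 ?sqr_ge0. Qed.

Lemma poissonN e u : poisson e (- u) = poisson e u.
Proof. by rewrite /poisson sqrrN. Qed.

Lemma cont_poisson e : 0 < e -> continuous (poisson e).
Proof.
move=> e0 u; apply: cvgM; first exact: cvg_cst.
apply: cvgV; first by rewrite gt_eqF// q_gt0.
by apply: cvgD; [exact: cvg_cst|exact: exprn_continuous].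
Qed.

Lemma mf_poisson e : 0 < e -> mf (poisson e).
Proof. by move=> e0; apply: continuous_measurable_fun; exact: cont_poisson. Qed.

Lemma poisson_int e : 0 < e -> L1 (poisson e) /\ \int[mu]_u poisson e u = pi.
Proof.
move=> e0; have mP := mf_poisson e0.
have dF (u : R) : is_derive u 1 (fun u => atan (e^-1 * u)) (poisson e u).
  have h : is_derive u 1 (fun u => e^-1 * u) e^-1 by apply: is_derive_eq; rewrite /GRing.scale/=; ring.
  have -> : poisson e u = (1 + (e^-1 * u) ^+ 2)^-1 * e^-1.
    by rewrite /poisson; field; rewrite !gt_eqF//= q_gt0.
  exact: (@is_derive1_comp _ atan (fun u => e^-1 * u) _ _ _ (is_derive1_atan _) h).
have E : (\int[mu]_(u in D) (poisson e u)%:E)%E = (pi / 2)%:E.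
  rewrite (@ge0_continuous_FTC2y _ (poisson e) (fun u => atan (e^-1 * u)) 0 (pi / 2)).
  - by rewrite mulr0 atan0 sube0.
  - by move=> u _; apply: poisson_ge0; exact: ltW.
  - by apply: continuous_subspaceT => u; exact: cont_poisson.
  - apply: (@cvg_comp _ _ _ (fun u => e^-1 * u) atan _ +oo); last exact: cvgy_atan.
    by apply: gt0_cvgMry; [rewrite invr_gt0|exact: cvg_id].
  - by move=> u _; have := dF u => -[].
  - apply: cvg_at_right_filter.
    by apply/differentiable_continuous/derivable1_diffP; have := dF 0 => -[].
  - by move=> u _; rewrite derive1E; have := dF u => -[].
have [LD LPE] := ge0_integrable (measurable_funS measurableT (@subsetT _ _) mP)
  (fun u _ => poisson_ge0 u (ltW e0)) E.
have LP : L1 (poisson e).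
  have mD : measurable D by exact: measurable_itv.
  have h : L1 (poisson e \_ D).
    by have := (@integrable_mkcond _ _ R mu D (EFin \o poisson e) mD).1 LD; rewrite restrict_EFin.
  apply: (L1_le mP (L1D h (L1_opp h))) => u.
  have P0 := poisson_ge0 u (ltW e0).
  rewrite ger0_norm// !patchE !mem_setE !in_itv/= !andbT oppr_ge0 poissonN.
  case: (leP 0 u) => u0; last by rewrite (ltW u0) add0r.
  by case: ifP => _; rewrite ?lerDl ?addr0.
split=> //; rewrite Rint_half//.
under eq_Rintegral do rewrite poissonN.
by rewrite RintegralD// LPE; field.
Qed.

End AbelIntegrals.

(** * The Hartley transform of an integrable function *)

Section Hartley.
Context {R : realType}.
Local Notation mu := (@lebesgue_measure R).
Local Notation mf f := (measurable_fun [set: R] (f : R -> R)).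
Implicit Types (f g h m : R -> R) (e u s t w : R).

(** Hartley's kernel: real, symmetric in w and t when taken at wt, and such that
    cas(wt) cas(ws) = cos(w(t - s)) + sin(w(t + s)), whose second term is odd in w. *)
Definition cas (x : R) : R := cos x + sin x.

Definition hartley f (w : R) : R := \int[mu]_t (f t * cas (w * t)).

Lemma cas_le2 x : `|cas x| <= 2.
Proof. by rewrite (le_trans (ler_normD _ _))// (_ : 2 = 1 + 1 :> R)// lerD ?cos_max ?sin_max. Qed.

Lemma mf_cas : mf cas.
Proof.
by apply: continuous_measurable_fun => x; apply: cvgD; [exact: continuous_cos|exact: continuous_sin].
Qed.

Lemma mf_casM w : mf (fun t => cas (w * t)).
Proof. by apply: (measurableT_comp mf_cas); exact: mulrl_measurable. Qed.

Lemma casM_L1 f w : L1 f -> L1 (fun t => f t * cas (w * t)).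
Proof.
move=> Lf; apply: (L1_le _ (L1Z 2 (L1_norm Lf))) => [|t].
  by apply: measurable_funM; [exact: L1_mf|exact: mf_casM].
by rewrite normrM mulrC ler_wpM2r// cas_le2.
Qed.

Lemma hartleyB f g w : L1 f -> L1 g ->
  hartley (fun t => f t - g t) w = hartley f w - hartley g w.
Proof.
move=> Lf Lg; rewrite /hartley -RintB; [|exact: casM_L1|exact: casM_L1].
by apply: eq_Rint => t; rewrite mulrBl.
Qed.

Let mf_kernel f m : mf f -> mf m ->
  measurable_fun [set: R * R] (fun p => m p.1 * f p.2 * cas (p.1 * p.2)).
Proof.
move=> mf' mm; apply: measurable_funM; first apply: measurable_funM.
- exact: (measurableT_comp mm measurable_fst).
- exact: (measurableT_comp mf' measurable_snd).
- by apply: (measurableT_comp mf_cas); apply: measurable_funM; [exact: measurable_fst|exact: measurable_snd].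
Qed.

Let fubini_cas f m : L1 f -> L1 m ->
  L1 (fun w => m w * hartley f w) /\
  \int[mu]_w (m w * hartley f w) = \int[mu]_t (f t * hartley m t).
Proof.
move=> Lf Lm.
have [||x y|] := @fubini_dom R (fun w t => m w * f t * cas (w * t))
  (fun w => `|m w|) (fun t => 2 * `|f t|) (mf_kernel (L1_mf Lf) (L1_mf Lm)).
- exact: L1_norm.
- exact: L1Z (L1_norm Lf).
- by rewrite !normrM -mulrA ler_wpM2l// mulrC ler_wpM2r// cas_le2.
move=> LI E.
have E1 w : \int[mu]_t (m w * f t * cas (w * t)) = m w * hartley f w.
  rewrite /hartley -(RintZ _ (casM_L1 w Lf)); apply: eq_Rint => t; by rewrite mulrA.
have E2 t : \int[mu]_w (m w * f t * cas (w * t)) = f t * hartley m t.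
  rewrite /hartley -(RintZ _ (casM_L1 t Lm)); apply: eq_Rint => w.
  by rewrite mulrA (mulrC (f t)) (mulrC w).
split; first by apply: eq_L1 LI => w; exact: E1.
by rewrite -(eq_Rint E1) E; exact: eq_Rint.
Qed.

(** Fubini's theorem, cas(wt) being symmetric in w and t. *)
Lemma hartley_sym f m : L1 f -> L1 m ->
  \int[mu]_w (hartley f w * m w) = \int[mu]_t (f t * hartley m t).
Proof.
move=> Lf Lm; rewrite -(fubini_cas Lf Lm).2.
by apply: eq_Rint => w; rewrite mulrC.
Qed.

Lemma mf_hartley f : L1 f -> mf (hartley f).
Proof.
move=> Lf; have [L _] := fubini_cas Lf (abel_L1 ltr01).
have -> : hartley f = (fun w => (abel 1 w * hartley f w) * expR `|w|).
  apply/funext => w; rewrite /abel mul1r mulrAC -expRD addNr expR0; ring.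
apply: measurable_funM; first exact: L1_mf.
by apply: (measurableT_comp (@measurable_expR R)); exact: normr_measurable.
Qed.

Lemma hartleyM_L1 f m : L1 f -> L1 m -> L1 (fun w => hartley f w * m w).
Proof.
by move=> Lf Lm; apply: eq_L1 (fubini_cas Lf Lm).1 => w; rewrite mulrC.
Qed.

Lemma Rint_odd g : L1 g -> (forall x, 0 < x -> g (- x) = - g x) -> \int[mu]_x g x = 0.
Proof.
move=> Lg go; rewrite Rint_half// -Rintegral_itv_obnd_cbnd; last first.
  by apply: integrableS (L1D Lg (L1_opp Lg)).
transitivity (\int[mu]_(x in (`]0, +oo[%classic : set R)) (0 : R)).
  by apply: eq_Rintegral => x; rewrite inE/= in_itv/= andbT => /go ->; rewrite subrr.
by rewrite Rintegral_cst// mul0r.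
Qed.

Lemma abel_cas_L1 e s : 0 < e -> L1 (fun w => abel e w * cas (s * w)).
Proof. by move=> e0; apply: casM_L1; exact: abel_L1. Qed.

(** The sine of w(s + t) integrates to 0 by parity and the cosine of w(s - t) gives
    the Poisson kernel. *)
Lemma hartley_abel e s t : 0 < e ->
  hartley (fun w => abel e w * cas (s * w)) t = 2 * poisson e (s - t).
Proof.
move=> e0; rewrite /hartley -int_abel_cos//.
have L1' : L1 (fun w => abel e w * cos (w * (s - t))).
  by apply: abelM_L1 => // [|w]; [exact: mf_cosM|exact: cos_max].
have L2' : L1 (fun w => abel e w * sin (w * (s + t))).
  by apply: abelM_L1 => // [|w]; [exact: mf_sinM|exact: sin_max].
rewrite -[RHS]addr0 -(Rint_odd L2'); last first.
  by move=> w _; rewrite abelN mulNr sinN mulrN.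
rewrite -RintD//; apply: eq_Rint => w.
rewrite (mulrBr w s t) (mulrDr w s t) cosB sinD /cas (mulrC w s) (mulrC w t); ring.
Qed.

(** The weight that brings out the conjugate Poisson kernel: the multiplier of the
    Hilbert transform times the Abel factor. *)
Definition conj_abel e t (w : R) : R := - (sgm w * abel e w * cas (- (t * w))).

Lemma conj_abel_L1 e t : 0 < e -> L1 (conj_abel e t).
Proof.
move=> e0; have La := abel_L1 e0.
apply: (L1_le _ (L1Z 2 La)) => [|w].
  apply: measurable_funN; apply: measurable_funM.
    by apply: measurable_funM; [exact: mf_sgm|exact: mf_abel].
  by apply: (measurableT_comp mf_cas); apply: measurable_funN; exact: mulrl_measurable.
rewrite normrN !normrM sgm_norm mul1r (ger0_norm (abel_ge0 _ _)) mulrC.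
by rewrite ler_wpM2r ?abel_ge0// cas_le2.
Qed.

Lemma hartley_conj_abel e t s : 0 < e ->
  hartley (conj_abel e t) s = 2 * ((t - s) / (e ^+ 2 + (t - s) ^+ 2)).
Proof.
move=> e0; rewrite /hartley -int_abel_sin//.
have L1' := sgm_abel_sin_L1 (t - s) e0.
have L2' : L1 (fun w => - (sgm w * abel e w * cos (w * (s + t)))).
  have h : L1 (fun w => abel e w * - (sgm w * cos (w * (s + t)))).
    apply: abelM_L1 => // [|w].
      by apply: measurable_funN; apply: measurable_funM; [exact: mf_sgm|exact: mf_cosM].
    by rewrite normrN normrM sgm_norm mul1r cos_max.
  by apply: eq_L1 h => w; ring.
rewrite -[RHS]addr0 -(Rint_odd L2'); last first.
  by move=> w w0; rewrite abelN sgmN ?gt_eqF// !mulNr cosN.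
rewrite -RintD//; apply: eq_Rint => w.
rewrite /conj_abel (mulrBr w t s) (mulrDr w s t) sinB cosD /cas cosN sinN (mulrC w s) (mulrC w t); ring.
Qed.

End Hartley.

(** * Bessel's inequality *)

Section Plancherel.
Context {R : realType}.
Local Notation mu := (@lebesgue_measure R).
Local Notation mf f := (measurable_fun [set: R] (f : R -> R)).
Implicit Types (f g h m : R -> R) (e u s t w : R).

(** Tonelli's theorem with real values: here the kernel f(s)^2 poisson e (t - s) is
    not dominated by an integrable product. *)
Lemma fubini_ge0 (F : R -> R -> R) :
  measurable_fun [set: R * R] (fun p => F p.1 p.2) -> (forall x y, 0 <= F x y) ->
  (forall x, L1 (F x)) -> (forall y, L1 (F^~ y)) -> L1 (fun x => \int[mu]_y F x y) ->
  L1 (fun y => \int[mu]_x F x y) /\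
  \int[mu]_y \int[mu]_x F x y = \int[mu]_x \int[mu]_y F x y.
Proof.
move=> mF F0 L1x L1y LI.
pose G := fun p : R * R => (F p.1 p.2)%:E.
have mG : measurable_fun [set: measurableTypeR R * measurableTypeR R] G.
  by apply/measurable_EFinP; exact: mF.
have G0 p : (0 <= G p)%E by rewrite lee_fin.
have E1 : (fun x => \int[mu]_y G (x, y))%E = EFin \o (fun x => \int[mu]_y F x y).
  by apply/funext => x; rewrite /= -RintE.
have E2 : (fun y => \int[mu]_x G (x, y))%E = EFin \o (fun y => \int[mu]_x F x y).
  by apply/funext => y; rewrite /= -RintE.
have := @fubini_tonelli _ _ _ _ R mu mu G mG G0; rewrite E1 E2 => E.
have mI : mf (fun y => \int[mu]_x F x y).
  have := @measurable_fun_fubini_tonelli_G _ _ _ _ R mu G mG G0.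
  by rewrite /fubini_G E2 => /measurable_EFinP.
split; last by rewrite /Rintegral; congr fine; rewrite -[LHS]E.
apply: L1P => //.
under eq_integral do rewrite ger0_norm ?Rint_ge0//.
by rewrite -[X in (X < _)%E]E (RintE LI) ltry.
Qed.

Let mf_convol f e : mf f -> 0 < e ->
  measurable_fun [set: R * R] (fun p => f p.2 * poisson e (p.1 - p.2)).
Proof.
move=> mf' e0; apply: measurable_funM; first exact: (measurableT_comp mf' measurable_snd).
apply: (measurableT_comp (mf_poisson e0)).
by apply: measurable_funB; [exact: measurable_fst|exact: measurable_snd].
Qed.

Lemma poisson_le e u : 0 < e -> poisson e u <= e^-1.
Proof.
move=> e0; rewrite /poisson ler_pdivrMr; last by rewrite ltr_wpDr ?sqr_ge0 ?exprn_gt0.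
rewrite mulrDr expr2 mulrA mulVf ?gt_eqF// mul1r lerDl.
by rewrite mulr_ge0 ?sqr_ge0// invr_ge0 ltW.
Qed.

Lemma poissonB_L1 e t : 0 < e -> L1 (fun s => poisson e (t - s)) /\
  \int[mu]_s poisson e (t - s) = pi.
Proof.
move=> e0; have [LP P] := poisson_int e0; split; first exact: L1_refl.
by rewrite Rint_refl//; exact: L1_mf.
Qed.

Lemma convol_L1 f e t : L1 f -> 0 < e -> L1 (fun s => f s * poisson e (t - s)).
Proof.
move=> Lf e0; have [LP _] := poissonB_L1 t e0.
apply: (L1_le _ (L1Z e^-1 (L1_norm Lf))) => [|s].
  by apply: measurable_funM; [exact: L1_mf|exact: L1_mf].
rewrite (normrM (f s)) mulrC (ger0_norm (poisson_ge0 _ (ltW e0))).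
by rewrite ler_wpM2r// poisson_le.
Qed.

Lemma poisson_form_L1 f e : L1 f -> 0 < e ->
  L1 (fun t => f t * \int[mu]_s (f s * poisson e (t - s))).
Proof.
move=> Lf e0; have mf' := L1_mf Lf.
have [|||x y|] := @fubini_dom R (fun t s => f t * (f s * poisson e (t - s)))
   (fun t => e^-1 * `|f t|) (fun s => `|f s|).
- apply: measurable_funM; first exact: (measurableT_comp mf' measurable_fst).
  exact: mf_convol.
- exact: L1Z (L1_norm Lf).
- exact: L1_norm.
- rewrite (normrM (f x)) (normrM (f y)) [`|poisson _ _|]ger0_norm ?poisson_ge0 ?(ltW e0)//.
  by rewrite mulrA mulrC mulrA ler_wpM2r// ler_wpM2r// poisson_le.
by move=> h _; apply: eq_L1 h => t; rewrite RintZ//; exact: convol_L1.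
Qed.

(** Schur's test for the Poisson kernel, from 2 f(t) f(s) <= f(t)^2 + f(s)^2. *)
Lemma schur_poisson f e : L1 f -> L2 f -> 0 < e ->
  \int[mu]_t (f t * \int[mu]_s (f s * poisson e (t - s))) <= pi * sqnorm f.
Proof.
move=> Lf L2f e0.
have mK := mf_convol (mf_sqr L2f.1) e0.
have E s : \int[mu]_t (f s ^+ 2 * poisson e (t - s)) = pi * f s ^+ 2.
  have [LP P] := poissonB_L1 s e0.
  rewrite mulrC -P -RintZ//; apply: eq_Rint => t; by rewrite -(poissonN _ (s - t)) opprB.
have [|||||LI EI] := @fubini_ge0 (fun s t => f s ^+ 2 * poisson e (t - s)).
- have mK' : measurable_fun [set: R * R] (fun p => f p.1 ^+ 2 * poisson e (p.2 - p.1)).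
    by have := measurableT_comp mK (@measurable_swap _ _ _ _).
  exact: mK'.
- by move=> s t; rewrite mulr_ge0 ?sqr_ge0// poisson_ge0// ltW.
- move=> s; apply: L1Z; have [LP _] := poisson_int e0.
  apply: eq_L1 (L1_refl s LP) => t; by rewrite -poissonN opprB.
- by move=> t; exact: convol_L1 L2f.2 e0.
- by apply: (@eq_L1 _ (fun s => pi * f s ^+ 2)) => //; exact: L1Z L2f.2.
rewrite (eq_Rint E) (RintZ _ L2f.2) -/(sqnorm f) in EI.
have bnd t : f t * \int[mu]_s (f s * poisson e (t - s)) <=
    pi / 2 * f t ^+ 2 + 2^-1 * \int[mu]_s (f s ^+ 2 * poisson e (t - s)).
  have [LP P] := poissonB_L1 t e0.
  have -> : pi / 2 * f t ^+ 2 = \int[mu]_s (f t ^+ 2 / 2 * poisson e (t - s)).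
    by rewrite RintZ// P; field.
  rewrite -RintZ; last exact: convol_L1.
  rewrite -RintZ; last exact: convol_L1 L2f.2 e0.
  rewrite -RintD; [|exact: L1Z|by apply: L1Z; exact: convol_L1 L2f.2 e0].
  apply: le_Rint; [by apply: L1Z; exact: convol_L1| |].
    by apply: L1D; [exact: L1Z|by apply: L1Z; exact: convol_L1 L2f.2 e0].
  move=> s; have := poisson_ge0 (t - s) (ltW e0); have := sqr_ge0 (f t - f s).
  nra.
have LJ := poisson_form_L1 Lf e0.
have LK : L1 (fun t => pi / 2 * f t ^+ 2 + 2^-1 * \int[mu]_s (f s ^+ 2 * poisson e (t - s))).
  by apply: L1D; apply: L1Z => //; exact: L2f.2.
apply: (le_trans (le_Rint LJ LK bnd)).
rewrite RintD; [|exact: L1Z L2f.2|exact: L1Z].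
rewrite (RintZ _ L2f.2) (RintZ _ LI) EI -/(sqnorm f); lra.
Qed.

(** Abel summation of the inverse transform of f produces Poisson means of f. *)
Lemma hartley_abel_conv f e t : L1 f -> 0 < e ->
  \int[mu]_w (hartley f w * (abel e w * cas (t * w))) =
  2 * \int[mu]_s (f s * poisson e (t - s)).
Proof.
move=> Lf e0; rewrite (hartley_sym Lf (abel_cas_L1 t e0)).
rewrite -RintZ; last exact: convol_L1.
by apply: eq_Rint => s; rewrite hartley_abel//; ring.
Qed.

(** The square norm on the left is the quadratic form of the Poisson kernel at f, by
    two applications of the multiplication formula. *)
Lemma bessel_abel f e : L1 f -> L2 f -> 0 < e ->
  L2 (fun w => hartley f w * abel e w) /\
  sqnorm (fun w => hartley f w * abel e w) <= 2 * pi * sqnorm f.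
Proof.
move=> Lf L2f e0; have e20 : 0 < e * 2 by rewrite mulr_gt0.
have abel2 w : abel e w ^+ 2 = abel (e * 2) w.
  by rewrite /abel -expRM_natl; congr expR; ring.
have Lm := hartleyM_L1 Lf (abel_L1 e20).
have E w : (hartley f w * abel e w) ^+ 2 = hartley f w * (hartley f w * abel (e * 2) w).
  by rewrite -abel2; ring.
have EE : sqnorm (fun w => hartley f w * abel e w) =
    2 * \int[mu]_t (f t * \int[mu]_s (f s * poisson (e * 2) (t - s))).
  rewrite /sqnorm (eq_Rint E) (hartley_sym Lf Lm).
  rewrite -RintZ; last exact: poisson_form_L1.
  apply: eq_Rint => t; rewrite mulrCA -hartley_abel_conv//; congr (_ * _).
  by apply: eq_Rint => w; ring.
split.
  split; first by apply: measurable_funM; [exact: mf_hartley|exact: mf_abel].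
  apply: (@eq_L1 _ (fun w => hartley f w * (hartley f w * abel (e * 2) w))) => [w|]; first by rewrite E.
  exact: hartleyM_L1.
rewrite EE -mulrA ler_pM2l//; exact: schur_poisson.
Qed.

(** Let the Abel factor tend to 1 and use Fatou's lemma. Only an inequality results;
    equality comes from inversion. *)
Lemma bessel f : L1 f -> L2 f ->
  L2 (hartley f) /\ sqnorm (hartley f) <= 2 * pi * sqnorm f.
Proof.
move=> Lf L2f; have k0 (k : nat) : 0 < k.+1%:R^-1 :> R by rewrite invr_gt0.
apply: (@fatou_L2 _ (fun k w => hartley f w * abel k.+1%:R^-1 w)).
- by move=> k; exact: (bessel_abel Lf L2f (k0 k)).1.
- exact: mf_hartley.
- apply: ae_all => w; rewrite -[X in _ --> X]mulr1; apply: cvgM; first exact: cvg_cst.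
  have h : - (k.+1%:R^-1 * `|w|) @[k --> \oo] --> (0 : R).
    rewrite -oppr0 -(mul0r `|w|); apply: cvgN; apply: cvgM; last exact: cvg_cst.
    exact: cvg_harmonic.
  rewrite -[X in _ --> X](expR0 R); exact: (cvg_comp _ _ h (@continuous_expR R 0)).
- by move=> k; exact: (bessel_abel Lf L2f (k0 k)).2.
Qed.

End Plancherel.

(** * The Hartley transform in mean *)

Section Extension.
Context {R : realType}.
Local Notation mu := (@lebesgue_measure R).
Local Notation mf f := (measurable_fun [set: R] (f : R -> R)).
Implicit Types (f g h m : R -> R) (e u s t w : R).

Lemma cvg0Z (c : R) (u : nat -> R) : u @ \oo --> 0 -> c * u n @[n --> \oo] --> 0.
Proof. by move=> u0; rewrite -[X in _ --> X](mulr0 c); apply: cvgM u0; exact: cvg_cst. Qed.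

Lemma cvg0D (u v : nat -> R) : u @ \oo --> 0 -> v @ \oo --> 0 ->
  u n + v n @[n --> \oo] --> 0.
Proof. by move=> u0 v0; rewrite -[X in _ --> X](addr0 0); exact: cvgD. Qed.

(** The integrals of F k times f tend to sqnorm f and are at most
    (M + sqnorm f) / 2. *)
Lemma sqnorm_lim_le (F : nat -> R -> R) f M : (forall k, L2 (F k)) -> L2 f ->
  sqnorm (fun x => F k x - f x) @[k --> \oo] --> 0 ->
  (forall k, sqnorm (F k) <= M) -> sqnorm f <= M.
Proof.
move=> LF Lf F0 FM; have ci := cvg_inner LF Lf Lf F0.
suff : sqnorm f <= 2^-1 * M + 2^-1 * sqnorm f by lra.
have {1}-> : sqnorm f = limn (fun k => \int[mu]_x (F k x * f x)).
  by rewrite (cvg_lim _ ci)//; apply: eq_Rint => x; rewrite expr2.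
apply: limr_le; first by apply/cvg_ex; eexists; exact: ci.
apply: nearW => k; apply: (@le_trans _ _ (2^-1 * sqnorm (F k) + 2^-1 * sqnorm f)).
  rewrite /sqnorm -(RintZ _ (LF k).2) -(RintZ _ Lf.2) -RintD; [|exact: L1Z (LF k).2|exact: L1Z Lf.2].
  apply: le_Rint; first exact: L2M.
    by apply: L1D; apply: L1Z; [exact: (LF k).2|exact: Lf.2].
  by move=> x; have := sqr_ge0 (F k x - f x); nra.
by rewrite lerD2r ler_pM2l.
Qed.

Lemma Rint_ae f g : mf f -> mf g -> {ae mu, forall x, f x = g x} ->
  \int[mu]_x f x = \int[mu]_x g x.
Proof.
move=> mf' mg fg; rewrite /Rintegral; congr fine; apply: ae_eq_integral => //.
- exact/measurable_EFinP.
- exact/measurable_EFinP.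
by apply: (ae_impl fg) => x -> _.
Qed.

Lemma sqnorm_ae f g : mf f -> mf g -> {ae mu, forall x, f x = g x} -> sqnorm f = sqnorm g.
Proof.
move=> mf' mg fg; apply: Rint_ae; [exact: mf_sqr|exact: mf_sqr|].
by apply: (ae_impl fg) => x ->.
Qed.

Lemma L2_ae f g : mf g -> L2 f -> {ae mu, forall x, f x = g x} -> L2 g.
Proof.
move=> mg Lf fg.
have [|//|//] := @fatou_L2 _ (fun=> f) g (sqnorm f) (fun=> Lf) mg.
by apply: (ae_impl fg) => x ->; exact: cvg_cst.
Qed.

Lemma sqnorm_cvg_unique (F : nat -> R -> R) f g : (forall k, L2 (F k)) -> L2 f -> L2 g ->
  sqnorm (fun x => F k x - f x) @[k --> \oo] --> 0 ->
  sqnorm (fun x => F k x - g x) @[k --> \oo] --> 0 ->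
  {ae mu, forall x, f x = g x}.
Proof.
move=> LF Lf Lg Ff Fg.
have h : {ae mu, forall x, f x - g x = 0}.
  apply: sqnorm_eq0; first exact: L2B.
  apply/eqP; rewrite eq_le sqnorm_ge0 andbT.
  have lim0 : 2 * sqnorm (fun x => F k x - f x) + 2 * sqnorm (fun x => F k x - g x) @[k --> \oo] --> (0 : R).
    by apply: cvg0D; exact: cvg0Z.
  rewrite -(cvg_lim _ lim0)//; apply: limr_ge; first by apply/cvg_ex; eexists; exact: lim0.
  by apply: nearW => k; rewrite (sqnormBC (F k) f); exact: sqnorm_dist.
by apply: (ae_impl h) => x /eqP; rewrite subr_eq0 => /eqP.
Qed.

(** The transform as a limit in mean, hence defined up to equality almost
    everywhere; a relation avoids choosing a representative. *)
Definition is_hartley f h : Prop := [/\ L2 f, L2 h &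
  sqnorm (fun w => hartley (trunc n f) w - h w) @[n --> \oo] --> 0].

Lemma hartley_trunc_L2 n f : L2 f -> L2 (hartley (trunc n f)).
Proof. by move=> Lf; apply: (bessel (trunc_L1 n Lf) (trunc_L2 n Lf)).1. Qed.

Lemma hartley_dist f g : L1 f -> L2 f -> L1 g -> L2 g ->
  sqnorm (fun w => hartley f w - hartley g w) <= 2 * pi * sqnorm (fun x => f x - g x).
Proof.
move=> f1 f2 g1 g2; have [_] := bessel (L1B f1 g1) (L2B f2 g2).
by congr (_ <= _); apply: eq_sqnorm => w; rewrite hartleyB.
Qed.

Lemma is_hartley_ex f : L2 f -> exists h, is_hartley f h.
Proof.
move=> Lf; have [k|e e0|h [Lh fh]] := @riesz_fischer R (fun n => hartley (trunc n f)).
- exact: hartley_trunc_L2.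
- have p0 : 0 < 8 * pi :> R by rewrite mulr_gt0// pi_gt0.
  have e0' : 0 < e / (8 * pi) by rewrite divr_gt0.
  have /cvgrPdist_le/(_ _ e0') [N _ HN] := trunc_cvg Lf.
  exists N => m n Nm Nn.
  apply: (le_trans (hartley_dist (trunc_L1 m Lf) (trunc_L2 m Lf) (trunc_L1 n Lf) (trunc_L2 n Lf))).
  have := sqnorm_dist (trunc_L2 m Lf) Lf (trunc_L2 n Lf).
  have := HN m Nm; have := HN n Nn; rewrite /= !sub0r !normrN !ger0_norm ?sqnorm_ge0//.
  rewrite (sqnormBC f); set a := sqnorm _; set b := sqnorm _; set d := sqnorm _ => a1 b1 d1.
  have E p : p != 0 -> e = 2 * p * (2 * (e / (8 * p)) + 2 * (e / (8 * p))) by move=> pN0; field.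
  rewrite (E pi) ?gt_eqF ?pi_gt0//.
  by rewrite ler_pM2l ?mulr_gt0 ?pi_gt0// (le_trans d1)// lerD// ler_pM2l.
by exists h.
Qed.

(** Go through truncations of f, using Bessel's inequality for g minus a truncation;
    each of the two triangle inequalities for squared norms costs a factor 2. *)
Lemma is_hartley_approx f h g : is_hartley f h -> L1 g -> L2 g ->
  sqnorm (fun w => hartley g w - h w) <= 8 * pi * sqnorm (fun x => g x - f x).
Proof.
move=> [Lf Lh fh] g1 g2.
have Lg := (bessel g1 g2).1.
have lim0 : 8 * pi * sqnorm (fun x => g x - f x) + 8 * pi * sqnorm (fun x => trunc n f x - f x)
   + 2 * sqnorm (fun w => hartley (trunc n f) w - h w) @[n --> \oo]
   --> 8 * pi * sqnorm (fun x => g x - f x) + 8 * pi * 0 + 2 * 0.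
  apply: cvgD; first apply: cvgD; first exact: cvg_cst.
    by apply: cvgM; [exact: cvg_cst|exact: trunc_cvg].
  by apply: cvgM; [exact: cvg_cst|exact: fh].
rewrite !mulr0 !addr0 in lim0.
rewrite -(cvg_lim _ lim0)//; apply: limr_ge; first by apply/cvg_ex; eexists; exact: lim0.
apply: nearW => n.
apply: (le_trans (sqnorm_dist Lg (hartley_trunc_L2 n Lf) Lh)).
rewrite lerD2r.
have := hartley_dist g1 g2 (trunc_L1 n Lf) (trunc_L2 n Lf).
have := sqnorm_dist g2 Lf (trunc_L2 n Lf); rewrite (sqnormBC f).
have := pi_gt0 R; set a := sqnorm _; set b := sqnorm _; set c := sqnorm _; set d := sqnorm _.
by move=> p0 h1 h2; nra.
Qed.

Lemma is_hartley_cvg f h (G : nat -> R -> R) : is_hartley f h ->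
  (forall k, L1 (G k)) -> (forall k, L2 (G k)) ->
  sqnorm (fun x => G k x - f x) @[k --> \oo] --> 0 ->
  sqnorm (fun w => hartley (G k) w - h w) @[k --> \oo] --> 0.
Proof.
move=> fh G1 G2 Gf; apply: cvg0_le (fun k => is_hartley_approx fh (G1 k) (G2 k)) _.
  by move=> k; exact: sqnorm_ge0.
exact: cvg0Z.
Qed.

Lemma is_hartley_le f h : is_hartley f h -> sqnorm h <= 2 * pi * sqnorm f.
Proof.
move=> [Lf Lh fh]; apply: (sqnorm_lim_le (F := fun n => hartley (trunc n f))) => // n.
  exact: hartley_trunc_L2.
apply: (le_trans (bessel (trunc_L1 n Lf) (trunc_L2 n Lf)).2).
by rewrite ler_pM2l ?trunc_sqnorm// mulr_gt0// pi_gt0.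
Qed.

(** Both sides are limits of the multiplication formula for truncations of f. *)
Lemma is_hartley_inner f h m : is_hartley f h -> L1 m -> L2 m ->
  \int[mu]_w (h w * m w) = \int[mu]_t (f t * hartley m t).
Proof.
move=> [Lf Lh fh] m1 m2.
have c1 := cvg_inner (fun n => hartley_trunc_L2 n Lf) Lh m2 fh.
have c2 := cvg_inner (fun n => trunc_L2 n Lf) Lf (bessel m1 m2).1 (trunc_cvg Lf).
rewrite -(cvg_lim _ c1)// -(cvg_lim _ c2)//; congr (lim (_ @ \oo)).
by apply/funext => n; rewrite hartley_sym//; exact: trunc_L1.
Qed.

Lemma is_hartley_ae f h g k : is_hartley f h -> mf g -> mf k ->
  {ae mu, forall x, f x = g x} -> {ae mu, forall w, h w = k w} -> is_hartley g k.
Proof.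
move=> [Lf Lh fh] mg mk fg hk.
have Lg := L2_ae mg Lf fg; have Lk := L2_ae mk Lh hk.
split=> //; suff <- : (fun n => sqnorm (fun w => hartley (trunc n f) w - h w)) =
  (fun n => sqnorm (fun w => hartley (trunc n g) w - k w)) by exact: fh.
apply/funext => n; apply: sqnorm_ae.
- exact: (L2B (hartley_trunc_L2 n Lf) Lh).1.
- exact: (L2B (hartley_trunc_L2 n Lg) Lk).1.
apply: (ae_impl hk) => w ->; congr (_ - _).
apply: Rint_ae.
- exact: L1_mf (casM_L1 w (trunc_L1 n Lf)).
- exact: L1_mf (casM_L1 w (trunc_L1 n Lg)).
by apply: (ae_impl fg) => t e; rewrite /trunc e.
Qed.

Lemma is_hartleyZ c f h : is_hartley f h -> is_hartley (fun x => c * f x) (fun w => c * h w).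
Proof.
move=> [Lf Lh fh]; split; [exact: L2Z|exact: L2Z|].
have E n : sqnorm (fun w => hartley (trunc n (fun x => c * f x)) w - c * h w) =
    c ^+ 2 * sqnorm (fun w => hartley (trunc n f) w - h w).
  rewrite -sqnormZ; last exact: L2B (hartley_trunc_L2 n Lf) Lh.
  apply: eq_sqnorm => w; rewrite mulrBr; congr (_ - _).
  rewrite /hartley -RintZ; last exact: casM_L1 (trunc_L1 n Lf).
  by apply: eq_Rint => t; rewrite /trunc; ring.
rewrite (_ : (fun n => _) = (fun n => c ^+ 2 * sqnorm (fun w => hartley (trunc n f) w - h w))).
  exact: cvg0Z.
by apply/funext.
Qed.

End Extension.

(** * Poisson means at Lebesgue points *)

Section LebesguePoints.
Context {R : realType}.
Local Notation mu := (@lebesgue_measure R).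
Local Notation mf f := (measurable_fun [set: R] (f : R -> R)).
Implicit Types (f g h m : R -> R) (e u s t w r : R).

Lemma L2_locally_integrable f : L2 f -> locally_integrable [set: R] f.
Proof.
move=> Lf; split; [exact: Lf.1|exact: openT|move=> K _ cK].
have mK : measurable K by exact: compact_measurable.
have Koo : (mu K < +oo)%E by exact: compact_finite_measure.
have L1K : mu.-integrable K (EFin \o (fun x => 1 + f x ^+ 2)).
  have h1 : mu.-integrable K (EFin \o (fun _ => 1 : R)).
    apply/integrableP; split; first by apply/measurable_EFinP; exact: measurable_cst.
    under eq_integral do rewrite gee0_abs ?lee_fin//.
    by rewrite integral_cst// mul1e.
  have h2 : mu.-integrable K (EFin \o (fun x => f x ^+ 2)) by apply: integrableS Lf.2.
  rewrite (_ : EFin \o _ = (fun x => (1 : R)%:E + (f x ^+ 2)%:E)%E); first exact: integrableD.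
  by apply/funext => x /=; rewrite EFinD.
move/integrableP : L1K => [m1]; apply: le_lt_trans.
apply: ge0_le_integral => //.
- apply/measurable_EFinP; apply: measurableT_comp => //.
  by apply: measurable_funS Lf.1.
- by apply: measurableT_comp => //.
move=> x _; rewrite lee_fin ger0_norm ?addr_ge0 ?sqr_ge0//.
by rewrite -(real_normK (num_real (f x))); have := sqr_ge0 (`|f x| - 1); nra.
Qed.

Definition dev f t (s : R) : R := `|f s - f t|.

Definition poisson_err f e t : R := \int[mu]_s (dev f t s * poisson e (t - s)).

Lemma dev_ge0 f t s : 0 <= dev f t s. Proof. exact: normr_ge0. Qed.

Lemma mf_dev f t : mf f -> mf (dev f t).
Proof. by move=> mf'; apply: measurableT_comp => //; exact: measurable_funB. Qed.

Lemma dev_poisson_L1 f e t : L2 f -> 0 < e -> L1 (fun s => dev f t s * poisson e (t - s)).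
Proof.
move=> Lf e0; have [LP _] := poissonB_L1 t e0.
have Lg := L1D (L1Z (1 + `|f t|) LP) (convol_L1 t Lf.2 e0).
apply: (L1_le _ Lg) => [|s].
  by apply: measurable_funM; [exact: mf_dev Lf.1|exact: L1_mf].
have P0 := poisson_ge0 (t - s) (ltW e0).
rewrite ger0_norm; last exact: mulr_ge0 (dev_ge0 f t s) P0.
rewrite -mulrDl ler_wpM2r//.
rewrite (le_trans (ler_normB _ _))//.
by rewrite -(real_normK (num_real (f s))); have := sqr_ge0 (`|f s| - 1); nra.
Qed.

Definition ballI t r (s : R) : R := \1_(ball t r) s.

Lemma ballIE t r s : ballI t r s = if `|t - s| < r then 1 else 0.
Proof.
rewrite /ballI indicE; case: ifP => h; first by rewrite mem_set.
by rewrite memNset// /ball/= h.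
Qed.

Lemma mf_ballI t r : mf (ballI t r).
Proof. by apply: measurable_indic; exact: measurable_ball. Qed.

Lemma ballI_ge0 t r s : 0 <= ballI t r s. Proof. by rewrite ballIE; case: ifP. Qed.

Lemma ballI_le1 t r s : ballI t r s <= 1. Proof. by rewrite ballIE; case: ifP. Qed.

Lemma dev_ball_L1 f t r : L2 f -> 0 < r -> L1 (fun s => dev f t s * ballI t r s).
Proof.
move=> Lf r0.
have := dev_poisson_L1 t Lf r0 => L.
apply: (L1_le _ (L1Z (2 * r) L)) => [|s].
  by apply: measurable_funM; [exact: mf_dev Lf.1|exact: mf_ballI].
have P0 := poisson_ge0 (t - s) (ltW r0); have d0 := dev_ge0 f t s.
rewrite ger0_norm; last exact: mulr_ge0 d0 (ballI_ge0 t r s).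
rewrite ballIE; case: ifP => h; last first.
  rewrite mulr0; apply: mulr_ge0; last exact: mulr_ge0.
  by rewrite mulr_ge0// ltW.
rewrite mulr1 mulrCA ler_peMr// /poisson mulrA ler_pdivlMr; last first.
  by rewrite ltr_wpDr ?sqr_ge0 ?exprn_gt0.
rewrite mul1r -mulrA -expr2 -(real_normK (num_real (t - s))).
by have := normr_ge0 (t - s); nra.
Qed.

Lemma lebesgue_pt_bound f t : L2 f -> lebesgue_pt f t -> forall eta, 0 < eta ->
  exists2 d, 0 < d & forall r, 0 < r -> r <= d ->
    \int[mu]_s (dev f t s * ballI t r s) <= 2 * r * eta.
Proof.
move=> Lf pt eta eta0.
have [d /= d0 H] : \forall r \near 0^'+, (davg f t r < eta%:E)%E.
  have : nbhs (0 : \bar R)%E [set x | (x < eta%:E)%E].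
    by apply: open_nbhs_nbhs; split; [exact: open_ereal_lt_ereal|rewrite /= lte_fin].
  by move/pt.
exists (d / 2); first by rewrite divr_gt0.
move=> r r0 rd; have := H r.
rewrite /= sub0r normrN gtr0_norm// => /(_ _ r0) h.
have {}h : (davg f t r < eta%:E)%E by apply: h; apply: le_lt_trans rd _; lra.
have L := dev_ball_L1 t Lf r0.
have E : (\int[mu]_(y in ball t r) `|((center (f t) \o f) y)%:E|)%E =
    (\int[mu]_s (dev f t s * ballI t r s))%:E.
  rewrite -(RintE L) integral_mkcond; apply: eq_integral => s _.
  rewrite patchE /ballI indicE; by case: (_ \in _); rewrite ?mulr1 ?mulr0.
move: h; rewrite /davg /iavg E lebesgue_measure_ball ?(ltW r0)//.
have r2 : 0 < r *+ 2 by rewrite pmulrn_lgt0.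
rewrite inver gt_eqF// -EFinM lte_fin mulrC ltr_pdivrMr// => h.
by move: h; rewrite -mulr_natl; lra.
Qed.

Let near_L1 f e t r : L2 f -> 0 < e -> L1 (fun s => dev f t s * poisson e (t - s) * ballI t r s).
Proof.
move=> Lf e0; have L := dev_poisson_L1 t Lf e0.
apply: (L1_le _ L) => [|s].
  by apply: measurable_funM; [exact: L1_mf L|exact: mf_ballI].
have h0 := mulr_ge0 (dev_ge0 f t s) (poisson_ge0 (t - s) (ltW e0)).
rewrite ger0_norm; last exact: mulr_ge0 h0 (ballI_ge0 t r s).
by rewrite ler_piMr// ballI_le1.
Qed.

(** On the disc |t - s| < e the kernel is at most 1/e, which contributes 2 eta. On the
    ring 2^K e <= |t - s| < 2^(K+1) e it is at most 1/(4^K e), which contributes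
    4 eta / 2^K. The partial sums are eta (10 - 8 / 2^K). *)
Let dyadic f e t d eta K : L2 f -> 0 < e -> 0 <= eta ->
  (forall r, 0 < r -> r <= d -> \int[mu]_s (dev f t s * ballI t r s) <= 2 * r * eta) ->
  2 ^+ K * e <= d ->
  \int[mu]_s (dev f t s * poisson e (t - s) * ballI t (2 ^+ K * e) s) <=
    eta * (10 - 8 / 2 ^+ K).
Proof.
move=> Lf e0 eta0 H; elim: K => [|K IH] Kd.
  rewrite expr0 mul1r in Kd *.
  apply: (@le_trans _ _ (\int[mu]_s (e^-1 * (dev f t s * ballI t e s)))).
    apply: le_Rint; [exact: near_L1|by apply: L1Z; exact: dev_ball_L1|move=> s].
    move: (poisson_le (t - s) e0) (dev_ge0 f t s) (ballI_ge0 t e s).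
    move: (poisson _ _) (dev _ _ _) (ballI _ _ _) => P d' b Pe d0 b0.
    by rewrite mulrAC [leRHS]mulrC ler_wpM2l// mulr_ge0.
  rewrite RintZ; last exact: dev_ball_L1.
  have := H e e0 Kd => h; rewrite -(@ler_pM2l _ e)// mulrA mulfV ?gt_eqF// mul1r.
  by rewrite (le_trans h)// divr1; lra.
have p2 : 0 < 2 ^+ K :> R by rewrite exprn_gt0.
have Kd' : 2 ^+ K * e <= d by rewrite (le_trans _ Kd)// exprS -mulrA; have := mulr_gt0 p2 e0; lra.
have r0 : 0 < 2 ^+ K.+1 * e by rewrite mulr_gt0// exprn_gt0.
have LB := dev_ball_L1 t Lf r0.
pose c := ((2 ^+ K) ^+ 2 * e)^-1.
apply: (@le_trans _ _ (\int[mu]_s (dev f t s * poisson e (t - s) * ballI t (2 ^+ K * e) s +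
    c * (dev f t s * ballI t (2 ^+ K.+1 * e) s)))).
  apply: le_Rint; [exact: near_L1|by apply: L1D; [exact: near_L1|exact: L1Z]|move=> s].
  have c0 : 0 <= c by rewrite invr_ge0 mulr_ge0 ?sqr_ge0// ltW.
  have ring_le : (`|t - s| < 2 ^+ K * e) = false -> poisson e (t - s) <= c.
    move/negbT; rewrite -leNgt => h1.
    have q : 0 < (2 ^+ K) ^+ 2 * e by rewrite mulr_gt0// exprn_gt0.
    rewrite /poisson ler_pdivrMr; last by rewrite ltr_wpDr ?sqr_ge0 ?exprn_gt0.
    rewrite /c mulrC ler_pdivlMr//.
    have : (2 ^+ K * e) ^+ 2 <= (t - s) ^+ 2.
      by rewrite -(real_normK (num_real (t - s))) lerXn2r ?nnegrE ?(ltW (mulr_gt0 p2 e0)).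
    by rewrite exprMn; have := sqr_ge0 e; lra.
  rewrite [in X in _ <= X + _]ballIE.
  move: (dev_ge0 f t s) (poisson_ge0 (t - s) (ltW e0)) ring_le.
  move: (ballI_ge0 t (2 ^+ K.+1 * e) s) (ballI_le1 t (2 ^+ K.+1 * e) s).
  move: (poisson _ _) (dev _ _ _) (ballI _ _ _) => P d' b b0 b1 d0 P0 ring_le.
  case: ifP => h1.
    rewrite mulr1 -[X in X <= _]addr0; apply: lerD.
      by rewrite ler_piMr// mulr_ge0.
    by rewrite mulr_ge0// mulr_ge0.
  rewrite mulr0 add0r mulrAC [leRHS]mulrC ler_wpM2l ?mulr_ge0//.
  exact: ring_le.
rewrite RintD; [|exact: near_L1|exact: L1Z].
rewrite (RintZ _ LB).
have h := H _ r0 Kd.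
have c0 : 0 < c by rewrite invr_gt0 mulr_gt0// exprn_gt0.
rewrite -(ler_pM2l c0) in h.
apply: (le_trans (lerD (IH Kd') h)).
rewrite le_eqVlt; apply/orP; left; apply/eqP; rewrite /c (exprS 2 K).
by field; rewrite !gt_eqF.
Qed.

Lemma dyadic_scale e d : 0 < e -> e <= d ->
  exists K, 2 ^+ K * e <= d /\ d < 2 ^+ K.+1 * e.
Proof.
move=> e0 ed.
have ex : exists K, d < 2 ^+ K * e.
  have [n _ /(_ n (leqnn _)) /= h] := near_infty_natSinv_expn_lt (PosNum (divr_gt0 e0 (lt_le_trans e0 ed))).
  exists n; move: h; rewrite div1r -(ltr_pM2l (exprn_gt0 n (ltr0n R 2))) mulfV ?expf_neq0//.
  by rewrite mulrA ltr_pdivlMr ?(lt_le_trans e0 ed)// mul1r.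
case: (ex_minnP ex) => -[|K] h hmin; first by move: h; rewrite expr0 mul1r ltNge ed.
exists K; split=> //; rewrite leNgt; apply/negP => /hmin.
by rewrite ltnn.
Qed.

(** Rings up to the scale d given by the Lebesgue point contribute at most 10/11 of
    eta; farther away the kernel is of order e times the kernel for e = 1. *)
Lemma poisson_err_small f t : L2 f -> lebesgue_pt f t -> forall eta, 0 < eta ->
  exists2 d, 0 < d & forall e, 0 < e -> e < d -> poisson_err f e t <= eta.
Proof.
move=> Lf pt eta eta0.
have eta'0 : 0 < eta / 11 by rewrite divr_gt0.
have [d d0 H] := lebesgue_pt_bound Lf pt eta'0.
pose C := 1 + 4 / d ^+ 2.
have C0 : 0 < C by rewrite /C ltr_wpDr// divr_ge0// sqr_ge0.
pose A := poisson_err f 1 t.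
have A0 : 0 <= A by apply: Rint_ge0 => s; exact: mulr_ge0 (dev_ge0 _ _ _) (poisson_ge0 _ ler01).
have CA : 0 < C * A + 1 by rewrite ltr_wpDl// mulr_ge0// ltW.
exists (Num.min d (eta / 11 / (C * A + 1))).
  by rewrite lt_min d0 divr_gt0.
move=> e e0; rewrite lt_min => /andP[ed eA].
have [K [Kd dK]] := dyadic_scale e0 (ltW ed).
have L1' := dev_poisson_L1 t Lf ltr01.
have near_le := dyadic Lf e0 (ltW eta'0) H Kd.
apply: (@le_trans _ _ (\int[mu]_s (dev f t s * poisson e (t - s) * ballI t (2 ^+ K * e) s +
    e * C * (dev f t s * poisson 1 (t - s))))).
  apply: le_Rint; [exact: dev_poisson_L1|by apply: L1D; [exact: near_L1|exact: L1Z]|move=> s].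
  have eC : 0 <= e * C by rewrite mulr_ge0// ltW.
  have far_le : (`|t - s| < 2 ^+ K * e) = false -> poisson e (t - s) <= e * C * poisson 1 (t - s).
    move/negbT; rewrite -leNgt => h1.
    have h2 : (d / 2) ^+ 2 <= (t - s) ^+ 2.
      rewrite -(real_normK (num_real (t - s))) lerXn2r ?nnegrE ?divr_ge0 ?(ltW d0)//.
      by rewrite (le_trans _ h1)// ler_pdivrMr//; move: dK; rewrite exprS; lra.
    rewrite /poisson expr1n; set u := (t - s) ^+ 2 in h2 *.
    have u0 : 0 <= u by exact: sqr_ge0.
    rewrite ler_pdivrMr; last by rewrite ltr_wpDr ?exprn_gt0.
    rewrite mul1r mulrAC ler_pdivlMr; last by rewrite ltr_wpDr.
    rewrite -mulrA ler_pM2l//.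
    have : 1 + u <= C * u.
      rewrite /C mulrDl mul1r addrC lerD2l.
      rewrite mulrAC ler_pdivlMr ?exprn_gt0//; move: h2; rewrite expr_div_n; lra.
    have : 0 <= C * e ^+ 2 by rewrite mulr_ge0 ?sqr_ge0// ltW.
    rewrite mulrDr; lra.
  rewrite ballIE.
  move: (dev_ge0 f t s) (poisson_ge0 (t - s) (ltW e0)) (poisson_ge0 (t - s) (@ler01 R)) far_le.
  move: (poisson e _) (poisson 1 _) (dev _ _ _) => P P' d' d0' P0 P'0 far_le.
  case: ifP => h1.
    by rewrite mulr1 lerDl mulr_ge0// mulr_ge0.
  rewrite mulr0 add0r mulrCA ler_wpM2l//.
  exact: far_le.
rewrite RintD; [|exact: near_L1|exact: L1Z].
rewrite (RintZ _ L1') -/(poisson_err f 1 t) -/A.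
have : e * (C * A + 1) < eta / 11 by rewrite -ltr_pdivlMr.
have : eta / 11 * (10 - 8 / 2 ^+ K) <= eta / 11 * 10.
  by rewrite ler_pM2l// gerBl divr_ge0// exprn_ge0.
move: near_le; lra.
Qed.

End LebesguePoints.

(** * Inversion and isometry *)

Section Inversion.
Context {R : realType}.
Local Notation mu := (@lebesgue_measure R).
Local Notation mf f := (measurable_fun [set: R] (f : R -> R)).
Implicit Types (f g h m k : R -> R) (e u s t w r : R).

Definition approx_pt f t : Prop := forall eta, 0 < eta ->
  exists2 d, 0 < d & forall e, 0 < e -> e < d -> poisson_err f e t <= eta.

Lemma ae_approx_pt f : L2 f -> {ae mu, forall t, approx_pt f t}.
Proof.
move=> Lf; have h := lebesgue_differentiation (L2_locally_integrable Lf).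
by apply: (ae_impl h) => t pt; exact: poisson_err_small.
Qed.

Lemma poisson_L2 e t : 0 < e -> L2 (fun s => poisson e (t - s)).
Proof.
move=> e0; have [LP _] := poissonB_L1 t e0; split; first exact: L1_mf.
apply: (L1_le _ (L1Z e^-1 LP)) => [|s]; first exact: mf_sqr (L1_mf LP).
rewrite ger0_norm ?sqr_ge0// expr2 ler_wpM2r ?poisson_le// poisson_ge0//.
exact: ltW.
Qed.

Lemma poisson_conv_dist f e t : L2 f -> 0 < e ->
  `|\int[mu]_s (f s * poisson e (t - s)) - pi * f t| <= poisson_err f e t.
Proof.
move=> Lf e0; have [LP P] := poissonB_L1 t e0.
have L1' := L2M Lf (poisson_L2 t e0); have L2' := L1Z (f t) LP.
rewrite -P mulrC -RintZ// -RintB//.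
apply: (le_trans (norm_Rint_le (L1B L1' L2'))); apply: le_Rint.
- exact: L1_norm (L1B L1' L2').
- exact: dev_poisson_L1.
move=> s; rewrite -mulrBl normrM [X in _ * X]ger0_norm//.
by apply: poisson_ge0; exact: ltW.
Qed.

Lemma abel_cas_L2 e t : 0 < e -> L2 (fun w => abel e w * cas (t * w)).
Proof.
move=> e0; apply: (L2_le _ (L2Z 2 (abel_L2 e0)) _).1 => [|w].
  by apply: measurable_funM; [exact: mf_abel|exact: mf_casM].
by rewrite mulrC !normrM ler_wpM2r// (ger0_norm (ler0n _ 2)) cas_le2.
Qed.

Lemma is_hartley_poisson f h e t : is_hartley f h -> 0 < e ->
  \int[mu]_w (h w * (abel e w * cas (t * w))) = 2 * \int[mu]_s (f s * poisson e (t - s)).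
Proof.
move=> fh e0; rewrite (is_hartley_inner fh (abel_cas_L1 t e0) (abel_cas_L2 t e0)).
have [Lf _ _] := fh.
rewrite -RintZ; last exact: L2M Lf (poisson_L2 t e0).
by apply: eq_Rint => s; rewrite hartley_abel//; ring.
Qed.

Let ek (n : nat) : R := n.+1%:R^-1.
Let ek0 n : 0 < ek n. Proof. by rewrite invr_gt0. Qed.

Let hk_L2 h n : L2 h -> L2 (fun w => h w * abel (ek n) w).
Proof.
move=> Lh; apply: (L2_le _ Lh _).1 => [|w].
  by apply: measurable_funM; [exact: Lh.1|exact: mf_abel].
by rewrite normrM (ger0_norm (abel_ge0 _ _)) ler_piMr// abel_le1// ltW.
Qed.

Let hk_cvg h : L2 h -> sqnorm (fun w => h w * abel (ek n) w - h w) @[n --> \oo] --> 0.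
Proof.
move=> Lh; apply: (dct_L2 _ Lh.1 Lh) => [n|n w|w].
- exact: (hk_L2 n Lh).1.
- by rewrite normrM (ger0_norm (abel_ge0 _ _)) ler_piMr// abel_le1// ltW.
rewrite -[X in _ --> X]mulr1; apply: cvgM; first exact: cvg_cst.
have c : - (ek n * `|w|) @[n --> \oo] --> (0 : R).
  rewrite -oppr0 -(mul0r `|w|); apply: cvgN; apply: cvgM; last exact: cvg_cst.
  exact: cvg_harmonic.
by rewrite -[X in _ --> X](expR0 R); exact: (cvg_comp _ _ c (@continuous_expR R 0)).
Qed.

(** The Hartley transform of h exp(-e|w|) is twice the Poisson mean of f at scale e.
    As e tends to 0 it converges in mean to the transform of h, and to 2 pi f at the
    Lebesgue points of f. *)
Lemma is_hartley_inv f h : is_hartley f h -> is_hartley h (fun t => 2 * pi * f t).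
Proof.
move=> fh; have [Lf Lh _] := fh; have [k hk] := is_hartley_ex Lh.
have [_ Lk _] := hk.
have G1 n : L1 (fun w => h w * abel (ek n) w) by exact: L2M Lh (abel_L2 (ek0 n)).
have G2 n := hk_L2 n Lh.
have HG n t : hartley (fun w => h w * abel (ek n) w) t =
    2 * \int[mu]_s (f s * poisson (ek n) (t - s)).
  by rewrite -(is_hartley_poisson t fh (ek0 n)); apply: eq_Rint => w; rewrite mulrA.
have LHG n := (bessel (G1 n) (G2 n)).1.
have cv := is_hartley_cvg hk G1 G2 (hk_cvg Lh).
have pc : {ae mu, forall t, hartley (fun w => h w * abel (ek n) w) t @[n --> \oo] --> 2 * pi * f t}.
  apply: (ae_impl (ae_approx_pt Lf)) => t pt.
  apply/cvgrPdist_le => eta eta0; have [d d0 H] := pt _ (divr_gt0 eta0 (ltr0n R 2)).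
  near=> n; rewrite HG distrC -mulrA -mulrBr normrM ger0_norm//.
  rewrite -ler_pdivlMl// [X in _ <= X]mulrC; apply: (le_trans (poisson_conv_dist t Lf (ek0 n))).
  apply: H => //; near: n.
  by have := near_infty_natSinv_lt (PosNum d0).
have Lpf := L2Z (2 * pi) Lf.
have key eta : 0 < eta -> sqnorm (fun t => 2 * pi * f t - k t) <= eta.
  move=> eta0; move/cvgrPdist_le : cv => /(_ _ eta0)[N _ HN].
  have [n|||n|_] := @fatou_L2 R (fun n t => hartley (fun w => h w * abel (ek (n + N)) w) t - k t)
     (fun t => 2 * pi * f t - k t) eta.
  - exact: L2B.
  - exact: (L2B Lpf Lk).1.
  - apply: (ae_impl pc) => t ct; apply: cvgB; last exact: cvg_cst.
    by rewrite (cvg_shiftn N (fun n => hartley (fun w => h w * abel (ek n) w) t)).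
  - by have := HN (n + N)%N (leq_addl _ _); rewrite /= sub0r normrN ger0_norm ?sqnorm_ge0.
  by [].
have k0 : sqnorm (fun t => 2 * pi * f t - k t) = 0.
  apply/eqP; rewrite eq_le sqnorm_ge0 andbT; apply/ler_addgt0Pr => eta eta0.
  by rewrite add0r key.
have kE := sqnorm_eq0 (L2B Lpf Lk) k0.
apply: (is_hartley_ae hk Lh.1 Lpf.1); first exact: ae_all.
by apply: (ae_impl kE) => t /eqP; rewrite subr_eq0 => /eqP.
Unshelve. all: by end_near. Qed.

(** Bessel's inequality for f and for its double transform 2 pi f leaves no gap. *)
Lemma is_hartley_isometry f h : is_hartley f h -> sqnorm h = 2 * pi * sqnorm f.
Proof.
move=> fh; apply/eqP; rewrite eq_le is_hartley_le//=.
have [Lf Lh _] := fh; have := is_hartley_le (is_hartley_inv fh).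
have p0 : 0 < 2 * pi :> R by rewrite mulr_gt0// pi_gt0.
by rewrite sqnormZ// expr2 -mulrA ler_pM2l.
Qed.

End Inversion.

(** * The Hilbert transform almost everywhere *)

Section Hilbert.
Context {R : realType}.
Local Notation mu := (@lebesgue_measure R).
Local Notation mf f := (measurable_fun [set: R] (f : R -> R)).
Implicit Types (f g h m k : R -> R) (e u s t w r : R).

Definition conj_poisson e u : R := u / (e ^+ 2 + u ^+ 2).

(** The difference between the conjugate Poisson kernel and the truncated kernel
    of the principal value. *)
Definition kernel_gap e u : R := conj_poisson e u - (if e < `|u| then u^-1 else 0).

Let q_gt0 e u : 0 < e -> 0 < e ^+ 2 + u ^+ 2.
Proof. by move=> e0; rewrite ltr_wpDr ?sqr_ge0 ?exprn_gt0. Qed.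

Lemma mf_conj_poisson e : 0 < e -> mf (conj_poisson e).
Proof.
move=> e0; apply: continuous_measurable_fun => u; apply: cvgM; first exact: cvg_id.
apply: cvgV; first by rewrite gt_eqF// q_gt0.
by apply: cvgD; [exact: cvg_cst|exact: exprn_continuous].
Qed.

Lemma conj_poisson_L2 e t : 0 < e -> L2 (fun s => conj_poisson e (t - s)).
Proof.
move=> e0; have mq := mf_conj_poisson e0; have [LP _] := poissonB_L1 t e0.
have mq' := mf_refl t mq; split=> //.
apply: (L1_le _ (L1Z e^-1 LP)) => [|s]; first exact: mf_sqr.
rewrite ger0_norm ?sqr_ge0// /conj_poisson /poisson.
have := q_gt0 (t - s) e0; set q := _ + _ => q0.
have -> : e^-1 * (e / q) = 1 / q by field; rewrite !gt_eqF.
rewrite expr_div_n ler_pdivrMr ?exprn_gt0//.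
have -> : 1 / q * q ^+ 2 = q by field; rewrite gt_eqF.
by rewrite /q lerDr sqr_ge0.
Qed.

Lemma kernel_gap_le e u : 0 < e -> `|kernel_gap e u| <= poisson e u.
Proof.
move=> e0; have q0 := q_gt0 u e0; rewrite /kernel_gap /conj_poisson /poisson.
set q := _ + _ in q0 *.
case: ltP => ue; last first.
  rewrite subr0 normrM (ger0_norm (_ : 0 <= q^-1)) ?invr_ge0 ?(ltW q0)//.
  by rewrite ler_wpM2r// invr_ge0 ltW.
have u0 : u != 0 by rewrite -normr_gt0 (lt_trans e0).
have -> : u / q - u^-1 = - (e ^+ 2 / (u * q)).
  by rewrite /q; field; rewrite u0/= gt_eqF.
rewrite normrN normf_div (normrM u) (gtr0_norm q0).
rewrite [`|e ^+ 2|]ger0_norm ?sqr_ge0//.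
rewrite invfM mulrA ler_wpM2r ?invr_ge0 ?(ltW q0)//.
by rewrite ler_pdivrMr ?normr_gt0// expr2 ler_pM2l// ltW.
Qed.

Lemma kernel_gapN e u : kernel_gap e (- u) = - kernel_gap e u.
Proof.
rewrite /kernel_gap /conj_poisson normrN sqrrN mulNr opprD opprK; congr (_ + _).
by case: ifP => _; rewrite ?invrN ?opprK ?oppr0.
Qed.

(** The inverse is the pointwise limit of conj_poisson e, including at 0, where both
    are 0. *)
Lemma mf_inv : mf (fun u => u^-1).
Proof.
apply: (@measurable_fun_cvg _ _ _ _ (fun n => conj_poisson n.+1%:R^-1)) => [n|u _].
  by apply: mf_conj_poisson; rewrite invr_gt0.
have [->|u0] := eqVneq u 0.
  rewrite invr0; apply: cvg_near_cst; apply: nearW => n.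
  by rewrite /conj_poisson mul0r.
rewrite [X in _ --> X](_ : u^-1 = u * (0 ^+ 2 + u ^+ 2)^-1); last first.
  by rewrite expr0n add0r; field.
apply: cvgM; first exact: cvg_cst.
apply: cvgV; first by rewrite expr0n add0r sqrf_eq0.
apply: cvgD; last exact: cvg_cst.
by rewrite expr2; apply: cvgM; exact: cvg_harmonic.
Qed.

Lemma mf_far e : mf (fun u => if e < `|u| then u^-1 else 0 : R).
Proof.
apply: measurable_fun_ifT; [|exact: mf_inv|exact: measurable_cst].
by apply: measurable_fun_ltr => //; exact: normr_measurable.
Qed.

Lemma mf_kernel_gap e : 0 < e -> mf (kernel_gap e).
Proof. by move=> e0; apply: measurable_funB; [exact: mf_conj_poisson|exact: mf_far]. Qed.

Lemma kernel_gap_L1 e t : 0 < e -> L1 (fun s => kernel_gap e (t - s)) /\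
  \int[mu]_s kernel_gap e (t - s) = 0.
Proof.
move=> e0; have [LP _] := poisson_int e0.
have L : L1 (kernel_gap e).
  by apply: (L1_le (mf_kernel_gap e0) LP) => u; exact: kernel_gap_le.
split; first exact: L1_refl.
rewrite Rint_refl//; last exact: mf_kernel_gap.
by apply: Rint_odd => // u _; exact: kernel_gapN.
Qed.

Lemma kernel_gap_fL1 f e t : L2 f -> 0 < e -> L1 (fun s => f s * kernel_gap e (t - s)).
Proof.
move=> Lf e0; have [L _] := kernel_gap_L1 t e0.
have Lp := L2M Lf (poisson_L2 t e0).
apply: (L1_le _ (L1_norm Lp)) => [|s].
  by apply: measurable_funM; [exact: Lf.1|exact: L1_mf L].
rewrite (normrM (f s)) (normrM (f s)) ler_wpM2l//.
by rewrite (le_trans (kernel_gap_le _ e0))// ler_norm.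
Qed.

(** The gap kernel is odd, so f(t) may be subtracted from f(s), and it is dominated
    by the Poisson kernel. *)
Lemma kernel_gap_err f e t : L2 f -> 0 < e ->
  `|\int[mu]_s (f s * kernel_gap e (t - s))| <= poisson_err f e t.
Proof.
move=> Lf e0; have [L L0] := kernel_gap_L1 t e0; have Lk := kernel_gap_fL1 t Lf e0.
have -> : \int[mu]_s (f s * kernel_gap e (t - s)) =
    \int[mu]_s (f s * kernel_gap e (t - s) - f t * kernel_gap e (t - s)).
  by rewrite (RintB Lk (L1Z (f t) L)) RintZ// L0 mulr0 subr0.
apply: (le_trans (norm_Rint_le (L1B Lk (L1Z (f t) L)))); apply: le_Rint.
- exact: L1_norm (L1B Lk (L1Z (f t) L)).
- exact: dev_poisson_L1.
by move=> s; rewrite -mulrBl normrM ler_wpM2l// kernel_gap_le.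
Qed.

Definition far_int f e t : R :=
  \int[mu]_(s in [set s : R | e < `|t - s|]) (f s / (t - s)).

Lemma far_intE f e t :
  far_int f e t = \int[mu]_s (f s * (if e < `|t - s| then (t - s)^-1 else 0)).
Proof.
rewrite /far_int Rintegral_mkcond; apply: eq_Rint => s.
rewrite patchE; have -> : (s \in [set s | e < `|t - s|]) = (e < `|t - s|).
  by apply/idP/idP; rewrite inE.
by case: ifP; rewrite ?mulr0.
Qed.

Lemma far_L1 f e t : L2 f -> 0 < e ->
  L1 (fun s => f s * (if e < `|t - s| then (t - s)^-1 else 0)).
Proof.
move=> Lf e0; apply: eq_L1 (L1B (L2M Lf (conj_poisson_L2 t e0)) (kernel_gap_fL1 t Lf e0)) => s.
by rewrite /kernel_gap; ring.
Qed.

Lemma far_int_dist f e t : L2 f -> 0 < e ->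
  `|\int[mu]_s (f s * conj_poisson e (t - s)) - far_int f e t| <= poisson_err f e t.
Proof.
move=> Lf e0; rewrite far_intE -RintB; [|exact: L2M Lf (conj_poisson_L2 t e0)|exact: far_L1].
apply: le_trans (kernel_gap_err t Lf e0).
by under eq_Rintegral do rewrite -mulrBr.
Qed.

(** The effect of the multiplier -j sgn(w) on the Hartley transform h: it exchanges
    the even and odd parts of h up to sign. *)
Definition conj_hartley h w : R := sgm w * h (- w).

Lemma conj_hartley_L2 h : L2 h -> L2 (conj_hartley h) /\ sqnorm (conj_hartley h) = sqnorm h.
Proof.
move=> Lh.
have E w : conj_hartley h w ^+ 2 = h (- w) ^+ 2.
  rewrite /conj_hartley exprMn -(real_normK (num_real (sgm w))) sgm_norm.
  by rewrite expr1n mul1r.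
split.
  split; first by apply: measurable_funM; [exact: mf_sgm|exact: mf_opp Lh.1].
  by apply: eq_L1 (L1_opp Lh.2) => w; rewrite E.
by rewrite /sqnorm (eq_Rint E) (Rint_opp (mf_sqr Lh.1)).
Qed.

Lemma ae_neq0 : {ae mu, forall w : R, w != 0}.
Proof.
exists [set 0]; split; [exact: measurable_set1|exact: lebesgue_measure_set1|].
by move=> w /= /negP; rewrite negbK => /eqP.
Qed.

(** The Poisson means of g are the conjugate Poisson means of f: both are
    computed from h by the multiplication formula. *)
Lemma conj_poisson_conv f g h e t : is_hartley f h -> is_hartley g (conj_hartley h) ->
  0 < e -> \int[mu]_s (f s * conj_poisson e (t - s)) = \int[mu]_s (g s * poisson e (t - s)).
Proof.
move=> fh gh e0; have [Lf Lh _] := fh; have [_ Lh' _] := gh.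
have m1 := conj_abel_L1 t e0.
have m2 : L2 (conj_abel e t).
  apply: (L2_le (L1_mf m1) (L2Z 2 (abel_L2 e0)) _).1 => w.
  rewrite normrN !normrM sgm_norm mul1r mulrC ler_wpM2r//.
  by rewrite (ger0_norm (ler0n _ 2)) cas_le2.
have := is_hartley_inner fh m1 m2.
have -> : \int[mu]_s (f s * hartley (conj_abel e t) s) =
    2 * \int[mu]_s (f s * conj_poisson e (t - s)).
  rewrite -RintZ; last exact: L2M Lf (conj_poisson_L2 t e0).
  by apply: eq_Rint => s; rewrite hartley_conj_abel// /conj_poisson; ring.
have -> : \int[mu]_w (h w * conj_abel e t w) =
    \int[mu]_w (conj_hartley h w * (abel e w * cas (t * w))).
  have mL : mf (fun w => h w * conj_abel e t w) by apply: L1_mf; exact: L2M.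
  rewrite -(Rint_opp mL); apply: Rint_ae.
  - exact: (mf_opp mL).
  - by apply: L1_mf; exact: L2M Lh' (abel_cas_L2 t e0).
  apply: (ae_impl ae_neq0) => w w0.
  rewrite /conj_abel /conj_hartley sgmN// abelN.
  have -> : - (t * - w) = t * w by ring.
  ring.
rewrite (is_hartley_poisson t gh e0) => /(mulfI _) -> //.
Qed.

Lemma hilbertE f t : hilbert f t = lim ((pi^-1 * far_int f e t) @[e --> 0^'+]).
Proof. by []. Qed.

(** The truncated integrals differ from the conjugate Poisson means of f, that is
    from the Poisson means of g, by the Poisson error of f. *)
Lemma hilbert_cvg f g h t : is_hartley f h -> is_hartley g (conj_hartley h) ->
  approx_pt f t -> approx_pt g t -> pi^-1 * far_int f e t @[e --> 0^'+] --> g t.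
Proof.
move=> fh gh fp gp; have [Lf Lh _] := fh; have [Lg _ _] := gh.
have pi0 := pi_gt0 R.
have -> : g t = pi^-1 * (pi * g t) by rewrite mulKf// gt_eqF.
apply: cvgM; first exact: cvg_cst.
apply/cvgrPdist_le => eta eta0; have eta2 : 0 < eta / 2 by rewrite divr_gt0.
have [d1 d10 H1] := fp _ eta2; have [d2 d20 H2] := gp _ eta2.
near=> e.
have e0 : 0 < e by near: e; exact: nbhs_right_gt.
have := far_int_dist t Lf e0; have := poisson_conv_dist t Lg e0.
rewrite -(conj_poisson_conv t fh gh e0).
have := H1 e e0; have := H2 e e0 => /(_ _) h2 /(_ _) h1.
have {}h1 : poisson_err f e t <= eta / 2 by apply: h1; near: e; exact: nbhs_right_lt.
have {}h2 : poisson_err g e t <= eta / 2 by apply: h2; near: e; exact: nbhs_right_lt.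
set a := \int[mu]_s _; set b := far_int _ _ _; set c := pi * g t => ac ab.
have -> : c - b = (a - b) - (a - c) by ring.
by rewrite (le_trans (ler_normB _ _))//; lra.
Unshelve. all: by end_near. Qed.

Lemma hilbert_ae f h : is_hartley f h -> exists g, is_hartley g (conj_hartley h) /\
  {ae mu, forall t, hilbert f t = g t}.
Proof.
move=> fh; have [Lf Lh _] := fh; have [Lh' _] := conj_hartley_L2 Lh.
have [k hk] := is_hartley_ex Lh'.
have gh := is_hartleyZ (2 * pi)^-1 (is_hartley_inv hk).
have p0 : 2 * pi != 0 :> R by rewrite mulf_neq0// gt_eqF// pi_gt0.
have {}gh : is_hartley (fun t => (2 * pi)^-1 * k t) (conj_hartley h).
  have E : (fun w => (2 * pi)^-1 * (2 * pi * conj_hartley h w)) = conj_hartley h.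
    by apply/funext => w; rewrite mulKf.
  by rewrite E in gh.
exists (fun t => (2 * pi)^-1 * k t); split=> //.
have [Lg _ _] := gh.
apply: (ae_impl (ae_and (ae_approx_pt Lf) (ae_approx_pt Lg))) => t [fp gp].
by rewrite hilbertE; apply: cvg_lim => //; exact: hilbert_cvg fh gh fp gp.
Qed.

End Hilbert.

(** * Borel measurability of the Hilbert transform *)

Section MeasurableHilbert.
Context {R : realType}.
Local Notation mu := (@lebesgue_measure R).
Local Notation mf f := (measurable_fun [set: R] (f : R -> R)).
Implicit Types (f : R -> R) (e u s t w r : R).

(** No integrability is required: the integral is the difference of the integrals of
    the positive and negative parts, each measurable by Tonelli's theorem. *)
Lemma mf_integral (F : R -> R -> R) :
  measurable_fun [set: R * R] (fun p => F p.1 p.2) -> mf (fun x => \int[mu]_y F x y).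
Proof.
move=> mF; pose G := fun p : R * R => (F p.1 p.2)%:E.
have mG : measurable_fun [set: measurableTypeR R * measurableTypeR R] G.
  by apply/measurable_EFinP; exact: mF.
apply: (@measurableT_comp _ _ _ _ _ _ fine _ (fun x => \int[mu]_y G (x, y))%E).
  exact: fine_measurable.
rewrite (_ : (fun x => \int[mu]_y G (x, y))%E =
   (fun x => \int[mu]_y G^\+ (x, y) - \int[mu]_y G^\- (x, y))%E); last first.
  apply/funext => x; rewrite integralE; congr (_ - _)%E;
    by apply: eq_integral => y _; rewrite unlock.
apply: emeasurable_funB.
- exact: (@measurable_fun_fubini_tonelli_F _ _ _ _ R mu _ (measurable_funepos mG) (funepos_ge0 G)).
- exact: (@measurable_fun_fubini_tonelli_F _ _ _ _ R mu _ (measurable_funeneg mG) (funeneg_ge0 G)).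
Qed.

Lemma mf_far_int f e : mf f -> mf (far_int f e).
Proof.
move=> mf'; rewrite (_ : far_int f e = (fun t =>
    \int[mu]_s (f s * (if e < `|t - s| then (t - s)^-1 else 0)))); last first.
  by apply/funext => t; exact: far_intE.
apply: mf_integral; apply: measurable_funM; first exact: (measurableT_comp mf' measurable_snd).
apply: (measurableT_comp (mf_far e)).
by apply: measurable_funB; [exact: measurable_fst|exact: measurable_snd].
Qed.

Lemma far_int_right f e t (d : nat -> R) : L2 f -> 0 < e -> (forall n, e < d n) ->
  d @ \oo --> e -> far_int f (d n) t @[n --> \oo] --> far_int f e t.
Proof.
move=> Lf e0 ed de; rewrite far_intE.
rewrite (_ : (fun n => _) = (fun n => \int[mu]_s
   (f s * (if d n < `|t - s| then (t - s)^-1 else 0)))); last first.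
  by apply/funext => n; exact: far_intE.
have L := far_L1 t Lf e0.
apply: (dct_L1 _ (L1_mf L) (L1_norm L)).
- by move=> n; apply: L1_mf; apply: far_L1 => //; exact: lt_trans (ed n).
- move=> n s; rewrite normrM [leRHS]normrM ler_wpM2l//.
  case: ifP => [h|_]; last by rewrite normr0.
  by rewrite (lt_trans (ed n) h).
move=> s; apply: cvgM; first exact: cvg_cst.
apply: cvg_near_cst; case: ifPn => [h|h]; last first.
  apply: nearW => n; rewrite ifF//; apply/negbTE; rewrite -leNgt.
  by move: h; rewrite -leNgt => h; rewrite (le_trans h)// ltW.
move/cvgrPdist_lt : de => /(_ (`|t - s| - e)); rewrite subr_gt0 => /(_ h).
apply: filterS => n /= hn; rewrite ifT//.
by move: hn; rewrite distrC ger0_norm ?subr_ge0 ?(ltW (ed n))//; lra.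
Qed.

(** Countably many scales suffice to express convergence at 0+, because the truncated
    integrals are right-continuous in the scale. *)
Definition posrat (c : nat) : R :=
  if unpickle c is Some (i, j) then (i : nat).+1%:R / (j : nat).+1%:R else 1.

Lemma posrat_gt0 c : 0 < posrat c.
Proof. by rewrite /posrat; case: unpickle => [[i j]|]//; rewrite divr_gt0. Qed.

Lemma posrat_dense e d : 0 < e -> e < d -> exists c, e < posrat c /\ posrat c < d.
Proof.
move=> e0 ed; have d0 : 0 < d - e by rewrite subr_gt0.
have [j _ /(_ j (leqnn _)) /= hj] := near_infty_natSinv_lt (PosNum d0).
pose i := Num.Def.trunc (e * j.+1%:R).
have ej : 0 <= e * j.+1%:R by rewrite mulr_ge0// ltW.
have /andP[h1 h2] := truncn_itv ej.
exists (pickle (i, j)); rewrite /posrat pickleK; split.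
  by rewrite ltr_pdivlMr.
rewrite ltr_pdivrMr// -natr1.
have : 1 < (d - e) * j.+1%:R by rewrite -ltr_pdivrMr// div1r.
rewrite /i; lra.
Qed.

Section RightLimit.
Variable Phi : R -> R -> R.
Hypothesis mPhi : forall e, 0 < e -> mf (Phi e).
Hypothesis rPhi : forall e t (d : nat -> R), 0 < e -> (forall n, e < d n) ->
  d @ \oo --> e -> Phi (d n) t @[n --> \oo] --> Phi e t.

Let close k n a b := [set t | posrat a < n.+1%:R^-1 -> posrat b < n.+1%:R^-1 ->
  `|Phi (posrat a) t - Phi (posrat b) t| <= k.+1%:R^-1].

Let conv := \bigcap_k \bigcup_n \bigcap_a \bigcap_b close k n a b.

Let measurable_conv : measurable conv.
Proof.
apply: bigcapT_measurable => k; apply: bigcupT_measurable => n.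
apply: bigcapT_measurable => a; apply: bigcapT_measurable => b.
rewrite /close; case: (ltP (posrat a) n.+1%:R^-1) => ha; last first.
  by rewrite (_ : [set t | _] = setT)//; apply/seteqP; split=> // t.
case: (ltP (posrat b) n.+1%:R^-1) => hb; last first.
  by rewrite (_ : [set t | _] = setT)//; apply/seteqP; split=> // t.
have mD : mf (fun t => `|Phi (posrat a) t - Phi (posrat b) t|).
  apply: measurableT_comp => //; apply: measurable_funB; apply: mPhi; exact: posrat_gt0.
have := measurable_fun_ler mD (@measurable_cst _ _ _ _ setT (k.+1%:R^-1 : R)).
move=> /(_ measurableT [set true] I); rewrite setTI.
by congr measurable; apply/seteqP; split=> t //= h; exact: h.
Qed.

Let right_close e d : 0 < e -> e < d -> exists a : nat -> nat,
  [/\ forall n, e < posrat (a n), forall n, posrat (a n) < d &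
   (fun n => posrat (a n)) @ \oo --> e].
Proof.
move=> e0 ed.
have ex n : exists c, e < posrat c /\ posrat c < Num.min d (e + n.+1%:R^-1).
  by apply: posrat_dense => //; rewrite lt_min ed ltrDl invr_gt0 ltr0n.
have [a ha] := choice ex; exists a; split.
- by move=> n; exact: (ha n).1.
- by move=> n; have [_] := ha n; rewrite lt_min => /andP[].
have h : e + n.+1%:R^-1 @[n --> \oo] --> e.
  by rewrite -[X in _ --> X]addr0; apply: cvgD; [exact: cvg_cst|exact: cvg_harmonic].
apply: (squeeze_cvgr _ (cvg_cst e) h); apply: nearW => n.
by have [h1] := ha n; rewrite lt_min => /andP[_ h2]; rewrite !ltW.
Qed.

Let convP t : conv t <-> cvg (Phi e t @[e --> 0^'+]).
Proof.
split=> [ct|/cvg_ex[l cl] k _].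
  apply/cauchy_cvgP/cauchy_exP => eps eps0.
  have [k _ /(_ k (leqnn _)) /= hk] := near_infty_natSinv_lt (PosNum eps0).
  have [n _ Hn] := ct k I.
  have n0 : 0 < n.+1%:R^-1 :> R by rewrite invr_gt0.
  have n20 : 0 < n.+1%:R^-1 / 2 :> R by rewrite divr_gt0.
  have [|b [_ hb]] := @posrat_dense (n.+1%:R^-1 / 2) n.+1%:R^-1 n20.
    by rewrite ltr_pdivrMr// ltr_pMr// ltr1n.
  exists (Phi (posrat b) t); rewrite /nbhs /=; near=> e.
  have e0 : 0 < e by near: e; exact: nbhs_right_gt.
  have en : e < n.+1%:R^-1 by near: e; exact: nbhs_right_lt.
  have [a [ea an ae]] := right_close e0 en.
  rewrite /ball /=; apply: le_lt_trans hk.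
  have c1 := @rPhi e t _ e0 ea ae.
  have c2 : `|Phi (posrat b) t - Phi (posrat (a m)) t| @[m --> \oo] --> `|Phi (posrat b) t - Phi e t|.
    by apply: cvg_norm; apply: cvgB; [exact: cvg_cst|exact: c1].
  rewrite -(cvg_lim _ c2)//; apply: limr_le; first by apply/cvg_ex; eexists; exact: c2.
  by apply: nearW => m; exact: Hn.
have k2 : 0 < k.+1%:R^-1 / 2 :> R by rewrite divr_gt0.
move/cvgrPdist_le : cl => /(_ _ k2)[d /= d0 H].
have [n _ /(_ n (leqnn _)) /= hn] := near_infty_natSinv_lt (PosNum d0).
exists n => // a _ b _ ha hb.
have close_l c : posrat c < n.+1%:R^-1 -> `|l - Phi (posrat c) t| <= k.+1%:R^-1 / 2.
  move=> hc; have pc := posrat_gt0 c; apply: H => //=.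
  by rewrite sub0r normrN gtr0_norm// (lt_trans hc).
have := close_l a ha; have := close_l b hb.
have -> : Phi (posrat a) t - Phi (posrat b) t = (l - Phi (posrat b) t) - (l - Phi (posrat a) t) by ring.
by move=> h1 h2; rewrite (le_trans (ler_normB _ _))// [leRHS]splitr lerD.
Unshelve. all: by end_near. Qed.

(** Convergence is a countable Cauchy condition, so the set where the limit exists is
    measurable; off this set the limit is a constant default value. *)
Lemma mf_right_lim : mf (fun t => lim (Phi e t @[e --> 0^'+])).
Proof.
pose g t := fine (limn_esup (fun n => (Phi n.+1%:R^-1 t)%:E)).
have mg : mf g.
  apply: (@measurableT_comp _ _ _ _ _ _ fine); first exact: fine_measurable.
  apply: measurable_fun_limn_esup => n; apply/measurable_EFinP; apply: mPhi.
  by rewrite invr_gt0.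
rewrite (_ : (fun t => _) = (fun t => g t * \1_conv t + (point : R) * \1_(~` conv) t)).
  apply: measurable_funD; apply: measurable_funM => //; apply: measurable_indic => //.
  exact: measurableC.
apply/funext => t; rewrite !indicE; have [ct|nct] := pselect (conv t).
  have nn : ~ (~` conv) t by [].
  rewrite (mem_set ct) (memNset nn) /= mulr1 mulr0 addr0.
  have /convP/cvg_ex[l cl] := ct.
  rewrite (cvg_lim _ cl)// /g.
  have h : (Phi n.+1%:R^-1 t)%:E @[n --> \oo] --> l%:E.
    apply: cvg_EFin; first exact: nearW.
    move/cvgrPdist_le : cl => cl; apply/cvgrPdist_le => eps /cl[d /= d0 H].
    near=> n; apply: H => //=.
    rewrite sub0r normrN gtr0_norm ?invr_gt0//.
    by near: n; have := near_infty_natSinv_lt (PosNum d0).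
  by rewrite (cvg_limn_einf_sup h).2.
rewrite (memNset nct) (mem_set (nct : (~` conv) t)) /= mulr0 mulr1 add0r.
by apply: dvgP; move=> /convP.
Unshelve. all: by end_near. Qed.

End RightLimit.

Lemma mf_hilbert f : L2 f -> mf (hilbert f).
Proof.
move=> Lf; apply: (@mf_right_lim (fun e t => pi^-1 * far_int f e t)).
- by move=> e e0; apply: measurable_funM => //; exact: mf_far_int Lf.1.
- move=> e t d e0 ed de; apply: cvgM; first exact: cvg_cst.
  exact: far_int_right.
Qed.

End MeasurableHilbert.

(** * From the Hartley to the Fourier transform *)

Local Open Scope complex_scope.

Section Fourier.
Context {R : realType}.
Local Notation mu := (@lebesgue_measure R).
Local Notation mf f := (measurable_fun [set: R] (f : R -> R)).
Local Notation Re := complex.Re.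
Local Notation Im := complex.Im.
Implicit Types (u v h k : R -> R) (f F G : R -> R[i]).

Lemma normc_sqr (z : R[i]) : normc z ^+ 2 = Re z ^+ 2 + Im z ^+ 2.
Proof. by case: z => a b /=; rewrite sqr_sqrtr// addr_ge0// sqr_ge0. Qed.

Definition L2_complex f : Prop := L2 (fun t => Re (f t)) /\ L2 (fun t => Im (f t)).

Lemma energyE f : L2_complex f ->
  energy f = (sqnorm (fun t => Re (f t)) + sqnorm (fun t => Im (f t)))%:E.
Proof.
move=> [Lr Li]; rewrite /sqnorm -(RintD Lr.2 Li.2) -(RintE (L1D Lr.2 Li.2)) /energy.
by under eq_integral do rewrite normc_sqr.
Qed.

Lemma finite_energyP f : finite_energy f <-> L2_complex f.
Proof.
split=> [[mr mi foo]|Lf]; last first.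
  by split; [exact: Lf.1.1|exact: Lf.2.1|rewrite energyE// ltry].
have Lf : L1 (fun t => Re (f t) ^+ 2 + Im (f t) ^+ 2).
  apply: L1P; first by apply: measurable_funD; exact: mf_sqr.
  under eq_integral do rewrite ger0_norm ?addr_ge0 ?sqr_ge0// -normc_sqr.
  exact: foo.
split; split=> //; apply: (L1_le _ Lf) => [|t]; [exact: mf_sqr| |exact: mf_sqr|].
  by rewrite ger0_norm ?sqr_ge0// lerDl sqr_ge0.
by rewrite ger0_norm ?sqr_ge0// lerDr sqr_ge0.
Qed.

Definition evenp h w : R := 2^-1 * (h w + h (- w)).
Definition oddp h w : R := 2^-1 * (h w - h (- w)).

Lemma L2_opp h : L2 h -> L2 (fun w => h (- w)) /\ sqnorm (fun w => h (- w)) = sqnorm h.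
Proof.
move=> Lh; split; last exact: Rint_opp (mf_sqr Lh.1).
by split; [exact: mf_opp Lh.1|exact: L1_opp Lh.2].
Qed.

Lemma evenp_L2 h : L2 h -> L2 (evenp h) /\ sqnorm (evenp h) <= sqnorm h.
Proof.
move=> Lh; have [Lh' Eh] := L2_opp Lh; have L := L2D Lh Lh'.
split; first exact: L2Z.
rewrite sqnormZ//; have := sqnormD Lh Lh'; rewrite Eh => /= le.
by rewrite expr2; lra.
Qed.

Lemma oddp_L2 h : L2 h -> L2 (oddp h) /\ sqnorm (oddp h) <= sqnorm h.
Proof.
move=> Lh; have [Lh' Eh] := L2_opp Lh; have L := L2B Lh Lh'.
split; first exact: L2Z.
rewrite sqnormZ//; have := sqnormD Lh (L2N Lh'); rewrite sqnormN Eh => /= le.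
by rewrite expr2; lra.
Qed.

(** The Fourier transform of u + iv in terms of the Hartley transforms of u and v:
    the cosine and sine transforms are the even and odd parts. *)
Definition spectrum h k : R -> R[i] :=
  fun w => (evenp h w + oddp k w) +i* (evenp k w - oddp h w).

Lemma spectrum_L2 h k : L2 h -> L2 k -> L2_complex (spectrum h k).
Proof.
move=> Lh Lk; have [e1 _] := evenp_L2 Lh; have [e2 _] := evenp_L2 Lk.
have [p1 _] := oddp_L2 Lh; have [p2 _] := oddp_L2 Lk.
by split; [exact: L2D|exact: L2B].
Qed.

Lemma hartley_cos u w : L1 u -> evenp (hartley u) w = \int[mu]_t (u t * cos (w * t)).
Proof.
move=> Lu; have L1' := casM_L1 w Lu; have L2' := casM_L1 (- w) Lu.
rewrite /evenp /hartley -(RintD L1' L2') -(RintZ _ (L1D L1' L2')); apply: eq_Rint => t.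
by rewrite /cas mulNr cosN sinN; field.
Qed.

Lemma hartley_sin u w : L1 u -> oddp (hartley u) w = \int[mu]_t (u t * sin (w * t)).
Proof.
move=> Lu; have L1' := casM_L1 w Lu; have L2' := casM_L1 (- w) Lu.
rewrite /oddp /hartley -(RintB L1' L2') -(RintZ _ (L1B L1' L2')); apply: eq_Rint => t.
by rewrite /cas mulNr cosN sinN; field.
Qed.

Lemma trig_L1 u w (c : R -> R) : L1 u -> mf c -> (forall x, `|c x| <= 1) ->
  L1 (fun t => u t * c (w * t)).
Proof.
move=> Lu mc c1; apply: (L1_le _ (L1_norm Lu)) => [|t].
  apply: measurable_funM; first exact: L1_mf.
  by apply: (measurableT_comp mc); exact: mulrl_measurable.
by rewrite normrM ler_piMr.
Qed.

Lemma truncated_fourierE f n : L2_complex f -> truncated_fourier f n =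
  spectrum (hartley (trunc n (fun t => Re (f t)))) (hartley (trunc n (fun t => Im (f t)))).
Proof.
move=> [Lr Li]; apply/funext => w.
have T1 := trunc_L1 n Lr; have T2 := trunc_L1 n Li.
have mc : mf cos by apply: continuous_measurable_fun; exact: continuous_cos.
have ms : mf sin by apply: continuous_measurable_fun; exact: continuous_sin.
rewrite /spectrum !hartley_cos// !hartley_sin// -RintD; last 2 first.
- exact: trig_L1 T1 mc (@cos_max R).
- exact: trig_L1 T2 ms (@sin_max R).
rewrite -RintB; last 2 first.
- exact: trig_L1 T2 mc (@cos_max R).
- exact: trig_L1 T1 ms (@sin_max R).
rewrite /truncated_fourier /cintegral; congr (_ +i* _);
  rewrite Rintegral_mkcond; apply: eq_Rint => t; rewrite patchE /trunc indicE;
  case: (_ \in _); rewrite ?mulr1 ?mulr0 ?mul0r ?addr0 ?subr0//;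
  by case: (f t) => a b; rewrite /expi/= cosN sinN; ring.
Qed.

Lemma spectrumB h k h' k' w : spectrum h k w - spectrum h' k' w =
  spectrum (fun w => h w - h' w) (fun w => k w - k' w) w.
Proof. by rewrite /spectrum /evenp /oddp; congr (_ +i* _); rewrite /=; ring. Qed.

Lemma spectrum_energy h k : L2 h -> L2 k ->
  exists2 x : R, energy (spectrum h k) = x%:E & 0 <= x <= 4 * sqnorm h + 4 * sqnorm k.
Proof.
move=> Lh Lk; have [e1 e1'] := evenp_L2 Lh; have [e2 e2'] := evenp_L2 Lk.
have [p1 o1'] := oddp_L2 Lh; have [p2 o2'] := oddp_L2 Lk.
exists (sqnorm (fun w => evenp h w + oddp k w) + sqnorm (fun w => evenp k w - oddp h w)).
  by rewrite energyE//; exact: spectrum_L2.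
rewrite addr_ge0 ?sqnorm_ge0//=.
by have := sqnormD e1 p2; have := sqnormD e2 (L2N p1); rewrite sqnormN; lra.
Qed.

Lemma is_fourier_spectrum f h k : is_hartley (fun t => Re (f t)) h ->
  is_hartley (fun t => Im (f t)) k -> is_fourier f (spectrum h k).
Proof.
move=> [Lr Lh fh] [Li Lk fk]; split; first by apply/finite_energyP; exact: spectrum_L2.
have Lf : L2_complex f by [].
have En n : energy (fun w => truncated_fourier f n w - spectrum h k w) =
   energy (spectrum (fun w => hartley (trunc n (fun t => Re (f t))) w - h w)
                    (fun w => hartley (trunc n (fun t => Im (f t))) w - k w)).
  by rewrite truncated_fourierE//; congr energy; apply/funext => w; rewrite spectrumB.
pose x n := fine (energy (fun w => truncated_fourier f n w - spectrum h k w)).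
have Hx n : energy (fun w => truncated_fourier f n w - spectrum h k w) = (x n)%:E /\
    0 <= x n <= 4 * sqnorm (fun w => hartley (trunc n (fun t => Re (f t))) w - h w) +
                4 * sqnorm (fun w => hartley (trunc n (fun t => Im (f t))) w - k w).
  have [y ey yb] := spectrum_energy (L2B (hartley_trunc_L2 n Lr) Lh) (L2B (hartley_trunc_L2 n Li) Lk).
  by rewrite /x En ey.
have -> : (fun n => energy (fun w => truncated_fourier f n w - spectrum h k w)) = EFin \o x.
  by apply/funext => n; have [] := Hx n.
apply: cvg_EFin; first exact: nearW.
apply: cvg0_le (cvg0D (cvg0Z 4 fh) (cvg0Z 4 fk)) => n.
  by have [_ /andP[]] := Hx n.
by have [_ /andP[]] := Hx n.
Qed.

(** The truncated transforms are measurable, so convergence in energy is convergence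
    in mean of the real and imaginary parts. *)
Lemma is_fourier_unique f F G : L2_complex f -> is_fourier f F -> is_fourier f G ->
  {ae mu, forall w, F w = G w}.
Proof.
move=> Lf [/finite_energyP LF fF] [/finite_energyP LG fG].
have LT n : L2_complex (truncated_fourier f n).
  rewrite truncated_fourierE//; apply: spectrum_L2; apply: hartley_trunc_L2;
    [exact: Lf.1|exact: Lf.2].
have cv F' : L2_complex F' -> energy (fun w => truncated_fourier f n w - F' w) @[n --> \oo] --> 0%E ->
    sqnorm (fun w => Re (truncated_fourier f n w) - Re (F' w)) @[n --> \oo] --> 0 /\
    sqnorm (fun w => Im (truncated_fourier f n w) - Im (F' w)) @[n --> \oo] --> 0.
  move=> LF' fF'.
  have ReB (z z' : R[i]) : Re (z - z') = Re z - Re z' by case: z; case: z'.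
  have ImB (z z' : R[i]) : Im (z - z') = Im z - Im z' by case: z; case: z'.
  have LD n : L2_complex (fun w => truncated_fourier f n w - F' w).
    split.
      by apply: eq_L2 (L2B (LT n).1 LF'.1) => w; rewrite ReB.
    by apply: eq_L2 (L2B (LT n).2 LF'.2) => w; rewrite ImB.
  have h : sqnorm (fun w => Re (truncated_fourier f n w) - Re (F' w)) +
           sqnorm (fun w => Im (truncated_fourier f n w) - Im (F' w)) @[n --> \oo] --> 0.
    rewrite (_ : (fun n => _) = (fun n => fine (energy (fun w => truncated_fourier f n w - F' w)))).
      exact: fine_cvg fF'.
    apply/funext => n /=.
    by rewrite energyE//=; congr (_ + _); apply: eq_sqnorm => w; rewrite ?ReB ?ImB.
  split; apply: cvg0_le h => n; rewrite ?sqnorm_ge0 ?lerDl ?lerDr ?sqnorm_ge0//.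
have [F1 F2] := cv F LF fF; have [G1 G2] := cv G LG fG.
have := ae_and (sqnorm_cvg_unique (fun n => (LT n).1) LF.1 LG.1 F1 G1)
               (sqnorm_cvg_unique (fun n => (LT n).2) LF.2 LG.2 F2 G2).
move=> H; apply: (ae_impl H) => w [].
by case: (F w) => a b; case: (G w) => a' b' /= -> ->.
Qed.

Lemma admissibility_spectrum f h k : is_hartley (fun t => Re (f t)) h ->
  is_hartley (fun t => Im (f t)) k ->
  admissibility_coef f = (\int[mu]_w ((normc (spectrum h k w)) ^+ 2 / `|w|)%:E)%E.
Proof.
move=> fh fk; have [Lr Lh _] := fh; have [Li Lk _] := fk.
have Lf : L2_complex f by [].
have fS := is_fourier_spectrum fh fk.
have fF : is_fourier f (fourier f) by rewrite /fourier; apply: xgetPex; exists (spectrum h k).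
have mI F : L2_complex F -> measurable_fun setT (fun w => (normc (F w) ^+ 2 / `|w|)%:E).
  move=> LF; apply/measurable_EFinP; apply: measurable_funM.
    rewrite (_ : (fun w => _) = (fun w => Re (F w) ^+ 2 + Im (F w) ^+ 2)); last first.
      by apply/funext => w; rewrite normc_sqr.
    by apply: measurable_funD; apply: mf_sqr; [exact: LF.1.1|exact: LF.2.1].
  by apply: (measurableT_comp (@mf_inv R)); exact: normr_measurable.
rewrite /admissibility_coef; apply: ae_eq_integral => //.
- by apply: mI; apply/finite_energyP; exact: fF.1.
- by apply: mI; exact: spectrum_L2.
by apply: (ae_impl (is_fourier_unique Lf fF fS)) => w -> _.
Qed.

End Fourier.

(** * Fourier-like wavelets *)

Section FourierLike.
Context {R : realType}.
Local Notation mu := (@lebesgue_measure R).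
Local Notation mf f := (measurable_fun [set: R] (f : R -> R)).
Local Notation Re := complex.Re.
Local Notation Im := complex.Im.
Implicit Types (psi h : R -> R) (Phi : R -> R).

Let c : R := (Num.sqrt 2)^-1.

Let c2 : c ^+ 2 = 2^-1.
Proof. by rewrite /c exprVn sqr_sqrtr. Qed.

Lemma is_hartley0 : is_hartley (fun=> 0 : R) (fun=> 0 : R).
Proof.
have L0 : L2 (fun=> 0 : R).
  split; first exact: measurable_cst.
  have := L1B (abel_L1 (@ltr01 R)) (abel_L1 (@ltr01 R)).
  by apply: eq_L1 => x; rewrite subrr expr0n.
have [h h0] := is_hartley_ex L0; have := is_hartleyZ 0 h0.
rewrite (_ : (fun x => 0 * 0) = fun=> 0); last by apply/funext => x; rewrite mul0r.
by rewrite (_ : (fun x => 0 * h x) = fun=> 0)//; apply/funext => x; rewrite mul0r.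
Qed.

Lemma fourier_like_ReIm psi t :
  (Re (fourier_like psi t) = c * psi t) * (Im (fourier_like psi t) = - c * hilbert psi t).
Proof. by rewrite /fourier_like -/c; split => /=; ring. Qed.

Lemma spectrum_real h w :
  normc (spectrum h (fun=> 0) w) ^+ 2 = evenp h w ^+ 2 + oddp h w ^+ 2.
Proof. by rewrite normc_sqr /= /evenp /oddp; ring. Qed.

(** The Hilbert transform multiplies the Fourier transform of psi by -j sgn, hence
    psi - j H(psi) multiplies it by 1 - sgn. *)
Lemma spectrum_fourier_like h w : w != 0 ->
  normc (spectrum (fun x => c * h x) (fun x => - c * conj_hartley h x) w) ^+ 2 =
  (if w < 0 then 2 else 0) * normc (spectrum h (fun=> 0) w) ^+ 2.
Proof.
move=> w0; rewrite spectrum_real normc_sqr /spectrum /evenp /oddp /conj_hartley /=.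
rewrite sgmN// opprK /sgm; case: ifP => _.
  transitivity (c ^+ 2 * (h w + h (- w)) ^+ 2 + c ^+ 2 * (h w - h (- w)) ^+ 2); first by field.
  by rewrite c2; field.
by rewrite mul0r; field.
Qed.

(** The reflection w |-> -w exchanges the two half-lines. *)
Lemma even_half Phi : mf Phi -> (forall w, 0 <= Phi w) -> (forall w, Phi (- w) = Phi w) ->
  Phi 0 = 0 ->
  (\int[mu]_w ((if w < 0 then 2 else 0) * Phi w)%:E = \int[mu]_w (Phi w)%:E)%E.
Proof.
move=> mPhi Phi0 PhiN Phi00.
pose a w : R := if w < 0 then Phi w else 0.
have a0 w : 0 <= a w by rewrite /a; case: ifP.
have ma : mf a.
  apply: measurable_fun_ifT => //.
  exact: measurable_fun_ltr.
have maN := mf_opp ma.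
have E1 w : ((if w < 0 then 2 else 0) * Phi w)%:E = ((a w)%:E + (a w)%:E)%E.
  by rewrite -EFinD /a; case: ifP => _; congr (_%:E); ring.
have E2 w : (Phi w)%:E = ((a w)%:E + (a (- w))%:E)%E.
  rewrite -EFinD /a oppr_lt0 PhiN; case: (ltgtP w 0) => [||->].
  - by rewrite addr0.
  - by rewrite add0r.
  - by rewrite Phi00 addr0.
under eq_integral do rewrite E1.
under [RHS]eq_integral do rewrite E2.
rewrite !ge0_integralD//; try (by move=> w _; rewrite lee_fin); try exact/measurable_EFinP.
congr (_ + _)%E.
have /measurable_EFinP ma' := ma.
have := integral_refl 0 ma' => /= <-.
by apply: eq_integral => w _; rewrite sub0r.
Qed.

End FourierLike.

Theorem proposition3 (R : realType) (psi : R -> R) :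
  wavelet (complex_of_real psi) ->
  wavelet (fourier_like psi) /\
  energy (fourier_like psi) = energy (complex_of_real psi) /\
  admissibility_coef (fourier_like psi) =
    admissibility_coef (complex_of_real psi).
Proof.
move=> [/finite_energyP [Lpsi Lpsi0] Cpsi].
have Lpsi_complex : L2_complex (complex_of_real psi) by split.
have {}Lpsi : L2 psi by exact: Lpsi.
have [h ph] := is_hartley_ex Lpsi.
have [g [gh hil]] := hilbert_ae ph.
have mh := mf_hilbert Lpsi.
have hh : is_hartley (hilbert psi) (conj_hartley h).
  have [Lg Lh' _] := gh.
  apply: (is_hartley_ae gh mh Lh'.1); last exact: ae_all.
  by apply: (ae_impl hil) => t ->.
have [Lhil _ _] := hh; have [_ Lh _] := ph.
pose c : R := (Num.sqrt 2)^-1.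
have c2 : c ^+ 2 = 2^-1 by rewrite /c exprVn sqr_sqrtr.
have Re_hartley : is_hartley (fun t => complex.Re (fourier_like psi t)) (fun w => c * h w).
  rewrite (_ : (fun t => _) = (fun t => c * psi t)); first exact: is_hartleyZ.
  by apply/funext => t; rewrite fourier_like_ReIm.
have Im_hartley : is_hartley (fun t => complex.Im (fourier_like psi t))
    (fun w => - c * conj_hartley h w).
  rewrite (_ : (fun t => _) = (fun t => - c * hilbert psi t)); first exact: is_hartleyZ.
  by apply/funext => t; rewrite fourier_like_ReIm.
have LF : L2_complex (fourier_like psi).
  by have [L1' _ _] := Re_hartley; have [L2' _ _] := Im_hartley.
have C_eq : admissibility_coef (fourier_like psi) = admissibility_coef (complex_of_real psi).
  rewrite (admissibility_spectrum Re_hartley Im_hartley).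
  rewrite (@admissibility_spectrum _ (complex_of_real psi) h (fun=> 0) ph (@is_hartley0 R)).
  pose Phi w := normc (spectrum h (fun=> 0) w) ^+ 2 / `|w|.
  rewrite -(@even_half _ Phi).
  - apply: eq_integral => w _; congr EFin; rewrite /Phi mulrA.
    have [->|w0] := eqVneq w 0; first by rewrite normr0 invr0 !mulr0.
    by congr (_ / _); exact: spectrum_fourier_like.
  - apply: measurable_funM; last by apply: (measurableT_comp (@mf_inv R)); exact: normr_measurable.
    have -> : (fun w => normc (spectrum h (fun=> 0) w) ^+ 2) =
        (fun w => evenp h w ^+ 2 + oddp h w ^+ 2).
      by apply/funext => w; rewrite spectrum_real.
    by apply: measurable_funD; apply: mf_sqr; [exact: (evenp_L2 Lh).1.1|exact: (oddp_L2 Lh).1.1].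
  - by move=> w; rewrite divr_ge0 ?sqr_ge0.
  - move=> w; rewrite /Phi normrN !spectrum_real; congr (_ / _).
    by rewrite /evenp /oddp opprK; ring.
  - by rewrite /Phi normr0 invr0 mulr0.
have E_eq : energy (fourier_like psi) = energy (complex_of_real psi).
  rewrite (energyE LF) (energyE Lpsi_complex); congr (_%:E).
  have -> : sqnorm (fun t => complex.Re (fourier_like psi t)) = c ^+ 2 * sqnorm psi.
    rewrite -(sqnormZ c Lpsi); apply: eq_sqnorm => t; exact: (fourier_like_ReIm psi t).1.
  have -> : sqnorm (fun t => complex.Im (fourier_like psi t)) = c ^+ 2 * sqnorm (hilbert psi).
    rewrite -sqrrN -(sqnormZ _ Lhil); apply: eq_sqnorm => t.
    exact: (fourier_like_ReIm psi t).2.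
  have -> : sqnorm (fun t => complex.Im (complex_of_real psi t)) = 0.
    transitivity (sqnorm (fun t : R => 0 * psi t)).
      by apply: eq_sqnorm => t; rewrite mul0r.
    by rewrite (sqnormZ 0 Lpsi) expr0n mul0r.
  have -> : sqnorm (hilbert psi) = sqnorm psi.
    have p0 : 2 * pi != 0 :> R := lt0r_neq0 (mulr_gt0 (ltr0Sn R 1) (pi_gt0 R)).
    apply: (mulfI p0); rewrite -(is_hartley_isometry ph) -(is_hartley_isometry hh).
    exact: (conj_hartley_L2 Lh).2.
  by rewrite c2 /=; field.
split; last by split; [exact: E_eq|exact: C_eq].
by split; [apply/finite_energyP; exact: LF|rewrite C_eq; exact: Cpsi].
Qed.
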